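(* Let $P_A(x,\mathrm{d}y)$ and $P_B(x,\mathrm{d}y)$ be propose-accept-reject Markov kernels on $(\mathcal{X},\mathcal{F})$, both targeting a distribution $\pi$, and using, respectively, proposal densities $q_A(x,y)$ and $q_B(x,y)$ and acceptance probabilities $\alpha_A(x,y)$ and $\alpha_B(x,y)$. If $P_A$ is variance bounding and for any $\epsilon>0$ there is a $\delta>0$ such that for $\pi$-almost all $x\in\mathcal{X}$ there is a region $\mathcal{D}(x)\in\mathcal{F}$ such that $$\int_{\mathcal{D}(x)^{c}} q_A(x,y)\,\alpha_A(x,y)\,\mathrm{d}y\le \epsilon$$ and $$y\in\mathcal{D}(x)\ \Rightarrow\ q_B(x,y)\,\alpha_B(x,y)\ \ge\ \delta\, q_A(x,y)\,\alpha_A(x,y),$$ then $P_B$ is also variance bounding.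
   Context: The state space is $(\mathcal{X},\mathcal{F})$ with $\mathcal{X}\subseteq\mathbb{R}^d$ Lebesgue measurable and $\mathcal{F}$ the $\sigma$-algebra of Lebesgue-measurable subsets of $\mathcal{X}$. The target distribution $\pi$ has a density $\pi(x)$ with respect to Lebesgue measure; all densities are with respect to Lebesgue measure. A propose-accept-reject kernel with proposal density $q(x,y)$ (a probability density in $y$ for each $x$) and acceptance probability $\alpha(x,y)\in[0,1]$ is $P(x,\mathrm{d}y)=q(x,y)\alpha(x,y)\,\mathrm{d}y+[1-\overline{\alpha}(x)]\delta_x(\mathrm{d}y)$, where $\overline{\alpha}(x)=\int q(x,y)\alpha(x,y)\,\mathrm{d}y$. It targets $\pi$ if $\pi$ is a stationary distribution for it. For a kernel $P$ with stationary distribution $\pi$ and associated chain $\{X_t\}_{t\ge1}$ with $X_1\sim\pi$, the asymptotic variance of a functional $h$ is $\mathsf{var}(h,P):=\lim_{n\to\infty} n\,\mathrm{Var}\left[\frac1n\sum_{i=1}^n h(X_i)\right]$. $P$ is variance bounding if $\mathsf{var}(h,P)<\infty$ for all $h\in L^2(\pi)$, the Hilbert space of functions that are square-integrable with respect to $\pi$. *)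

(* Defs.v *)
From HB Require Import structures.
From mathcomp Require Import all_boot all_order all_algebra.
From mathcomp Require Import all_classical all_reals all_analysis.
From mathcomp Require Import measurable_realfun.

Set Implicit Arguments.
Unset Strict Implicit.
Unset Printing Implicit Defensive.
Import Order.TTheory GRing.Theory Num.Theory.
Import numFieldNormedType.Exports.

Local Open Scope classical_set_scope.
Local Open Scope ring_scope.
Local Open Scope ereal_scope.

Section tuple_cons.
Context d (T : measurableType d) (n : nat).

Definition tcons (z : T * n.-tuple T) : n.+1.-tuple T := [tuple of z.1 :: z.2].

Lemma measurable_tcons_preimage (A : set (n.+1.-tuple T)) :
  measurable A -> measurable (tcons @^-1` A).
Proof.
have mc : measurable_fun [set: T * n.-tuple T] tcons by exact: measurable_cons.
by move=> mA; rewrite -[X in measurable X]setTI; exact: mc.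
Qed.

End tuple_cons.

Section tuple_product_measure.
Context d (T : measurableType d) (R : realType).

Section step.
Context n (m1 : {sigma_finite_measure set T -> \bar R})
  (m2 : {sigma_finite_measure set (n.-tuple T) -> \bar R}).

Definition tuple_product_step : set (n.+1.-tuple T) -> \bar R :=
  pushforward (m1 \x m2) (@tcons d T n).

Let step0 : tuple_product_step set0 = 0.
Proof. by rewrite /tuple_product_step /pushforward preimage_set0 measure0. Qed.

Let step_ge0 A : 0 <= tuple_product_step A.
Proof. by rewrite /tuple_product_step /pushforward; exact: measure_ge0. Qed.

Let step_semi_sigma_additive : semi_sigma_additive tuple_product_step.
Proof.
move=> F mF tF mUF; rewrite /tuple_product_step /pushforward preimage_bigcup.
apply: measure_semi_sigma_additive.
- by move=> i; exact: measurable_tcons_preimage.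
- apply/trivIsetP => /= i j _ _ ij; rewrite -preimage_setI.
  by move/trivIsetP : tF => /(_ _ _ _ _ ij) ->//; rewrite preimage_set0.
- by rewrite -preimage_bigcup; exact: measurable_tcons_preimage.
Qed.

HB.instance Definition _ := isMeasure.Build _ _ _ tuple_product_step
  step0 step_ge0 step_semi_sigma_additive.

Let step_sigma_finite : sigma_finite setT tuple_product_step.
Proof.
pose uncons (t : n.+1.-tuple T) := (tnth t ord0, [tuple of behead t]).
have unconsK : cancel (@tcons d T n) uncons.
  by case=> x t; congr pair; apply: val_inj.
have muncons : measurable_fun [set: n.+1.-tuple T] uncons.
  apply/measurable_fun_pairP; split; first exact: measurable_tnth.
  exact: measurable_behead.
have [F TF Foo] : sigma_finite setT (m1 \x m2).
  have /sigma_finiteP[F [TF ndF Foo]] := sigma_finiteT m1.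
  have /sigma_finiteP[G [TG ndG Goo]] := sigma_finiteT m2.
  exists (fun k => F k `*` G k).
    rewrite -setXTT TF TG predeqE => -[x y]; split.
      move=> [/= [i _ Fix] [j _ Gjy]]; exists (maxn i j) => //; split.
      - by move: x Fix; exact/subsetPset/ndF/leq_maxl.
      - by move: y Gjy; exact/subsetPset/ndG/leq_maxr.
    by move=> [i _ []/= ? ?]; split; exists i.
  move=> k; have [? ?] := Foo k; have [? ?] := Goo k.
  split; first exact: measurableX.
  by rewrite product_measure1E// lte_mul_pinfty// ge0_fin_numE.
exists (fun k => uncons @^-1` F k).
  by rewrite -preimage_bigcup -TF preimage_setT.
move=> k; have [mFk Fkoo] := Foo k; split.
  by rewrite -[X in measurable X]setTI; exact: muncons.
rewrite /tuple_product_step /pushforward -comp_preimage.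
by rewrite (_ : uncons \o _ = id)//; apply/funext => z; exact: unconsK.
Qed.

HB.instance Definition _ :=
  Measure_isSigmaFinite.Build _ _ _ tuple_product_step step_sigma_finite.

End step.

(* The n-fold product measure m \x ... \x m. *)
Fixpoint tuple_product_measure (m : {sigma_finite_measure set T -> \bar R}) n :
    {sigma_finite_measure set (n.-tuple T) -> \bar R} :=
  if n is k.+1 then tuple_product_step m (tuple_product_measure m k)
  else \d_([tuple] : 0.-tuple T).

End tuple_product_measure.

Section lebesgue.
Context (R : realType) (d : nat).

Definition lebesgue_borel :=
  tuple_product_measure (@lebesgue_measure R) d.

(* R^d with the Lebesgue sigma-algebra, i.e. the sets that are
   Caratheodory-measurable for the Lebesgue outer measure. *)
Definition euclidean := caratheodory_type (lebesgue_borel^*)%mu.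
HB.instance Definition _ := Measurable.on euclidean.

Definition lebesgue : {measure set euclidean -> \bar R} :=
  @completed_measure_extension _ _ _ lebesgue_borel.

End lebesgue.

Section state_space.
Context (R : realType) (d : nat).

(* Nonemptiness is implied by the existence of a probability measure; it is
   recorded because measurable types are required to be pointed. *)
Record state_space := StateSpace {
  state_set :> set (euclidean R d) ;
  measurable_state_set : measurable state_set ;
  state_set_nonempty : state_set !=set0
}.

Definition state (X : state_space) : Type :=
  {x : euclidean R d | x \in state_set X}.

Context (X : state_space).

HB.instance Definition _ := gen_eqMixin (state X).
HB.instance Definition _ := gen_choiceMixin (state X).
HB.instance Definition _ := isPointed.Build (state X)
  (exist (fun x => x \in state_set X) _
     (mem_set (projT2 (cid (state_set_nonempty X))))).

Definition state_val (x : state X) : euclidean R d := sval x.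

(* The sigma-algebra of Lebesgue-measurable subsets of X: as X is itself
   measurable, these are the traces on X of the Lebesgue-measurable sets. *)
HB.instance Definition _ :=
  Measurable.copy (state X) (g_sigma_algebra_preimageType state_val).

Lemma measurable_state_image (A : set (state X)) :
  measurable A -> measurable (state_val @` A).
Proof.
move=> [B mB <-]; rewrite setTI.
rewrite (_ : _ @` _ = B `&` X); first exact/measurableI/measurable_state_set.
apply/seteqP; split=> [_ [[y yX] By <-]|y [By Xy]].
  by split=> //; exact: set_mem.
by exists (exist _ y (mem_set Xy)).
Qed.

Let state_val_inj : injective state_val. Proof. exact: val_inj. Qed.

Definition lebesgue_on (A : set (state X)) : \bar R :=
  lebesgue R d (state_val @` A).

Let lebesgue_on0 : lebesgue_on set0 = 0.
Proof. by rewrite /lebesgue_on image_set0 measure0. Qed.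

Let lebesgue_on_ge0 A : 0 <= lebesgue_on A.
Proof. exact: measure_ge0. Qed.

Let lebesgue_on_semi_sigma_additive : semi_sigma_additive lebesgue_on.
Proof.
move=> F mF tF mUF; rewrite /lebesgue_on image_bigcup.
apply: measure_semi_sigma_additive.
- by move=> i; exact: measurable_state_image.
- apply/trivIsetP => i j _ _ ij; apply/seteqP; split => // _ [[x Fi <-] [y Fj]].
  move=> /state_val_inj yx; rewrite {y}yx in Fj.
  by move/trivIsetP : tF => /(_ _ _ I I ij) /seteqP[/(_ x) + _]; apply.
- by rewrite -image_bigcup; exact: measurable_state_image.
Qed.

HB.instance Definition _ := isMeasure.Build _ _ _ lebesgue_on
  lebesgue_on0 lebesgue_on_ge0 lebesgue_on_semi_sigma_additive.

End state_space.

Arguments lebesgue_on {R d} X A.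

Section law_cons.
Context d (T : measurableType d) (R : realType) (n : nat).

(* The law of (Y_0, ..., Y_n) when Y_0 has law m and, given Y_0 = y,
   (Y_1, ..., Y_n) has law k y. *)
Definition law_cons (m : set T -> \bar R)
    (k : T -> {measure set (n.-tuple T) -> \bar R}) (A : set (n.+1.-tuple T)) :
    \bar R :=
  \int[m]_y k y [set t : n.-tuple T | A [tuple of y :: t]].

Context (k : R.-pker T ~> n.-tuple T).

Let sectionE (A : set (n.+1.-tuple T)) y :
  [set t : n.-tuple T | A [tuple of y :: t]] = xsection (@tcons _ T n @^-1` A) y.
Proof. by rewrite xsectionE. Qed.

Lemma measurable_law_cons_section (A : set (n.+1.-tuple T)) y :
  measurable A -> measurable [set t : n.-tuple T | A [tuple of y :: t]].
Proof.
move=> mA; rewrite sectionE; apply: measurable_xsection; exact: measurable_tcons_preimage.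
Qed.

Lemma measurable_fun_law_cons_section (A : set (n.+1.-tuple T)) : measurable A ->
  measurable_fun [set: T]
    ((fun y => k y [set t : n.-tuple T | A [tuple of y :: t]]) : T -> \bar R).
Proof.
move=> mA.
rewrite (_ : (fun y => _) =
    (fun y => k y (xsection (@tcons _ T n @^-1` A) y))); last first.
  by apply/funext => y; rewrite sectionE.
apply: measurable_fun_xsection_finite_kernel.
by rewrite inE; exact: measurable_tcons_preimage.
Qed.

Section measure.
Context (m : {measure set T -> \bar R}).

Let law_cons0 : law_cons m k set0 = 0.
Proof. by apply: integral0_eq => y _; exact: measure0. Qed.

Let law_cons_ge0 A : 0 <= law_cons m k A.
Proof. by apply: integral_ge0 => y _; exact: measure_ge0. Qed.

Let law_cons_semi_sigma_additive : semi_sigma_additive (law_cons m k).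
Proof.
move=> F mF tF mUF.
rewrite [X in _ --> X](_ : _ = \sum_(i <oo) law_cons m k (F i)).
  by apply: is_cvg_ereal_nneg_natsum => i _; exact: law_cons_ge0.
rewrite -integral_nneseries//; last first.
  by move=> i; exact: measurable_fun_law_cons_section.
apply: eq_integral => y _.
rewrite [X in k y X](_ : _ = \bigcup_i [set t : n.-tuple T | F i [tuple of y :: t]])//.
apply/esym/cvg_lim => //; apply: measure_sigma_additive.
  by move=> i; exact: measurable_law_cons_section.
apply/trivIsetP => i j _ _ ij; apply/seteqP; split => // t [Fi Fj].
move/trivIsetP : tF => /(_ _ _ I I ij) /seteqP[/(_ [tuple of y :: t]) + _].
exact.
Qed.

HB.instance Definition _ := isMeasure.Build _ _ _ (law_cons m k)
  law_cons0 law_cons_ge0 law_cons_semi_sigma_additive.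

End measure.

Lemma law_consT (m : {measure set T -> \bar R}) :
  law_cons m k setT = m setT.
Proof.
rewrite /law_cons.
under eq_integral => y _ do rewrite [X in k y X](_ : _ = setT)// prob_kernel.
by rewrite integral_cst// mul1e.
Qed.

HB.instance Definition _ (m : probability T R) :=
  Measure_isProbability.Build _ _ _ (law_cons m k)
    (eq_trans (law_consT m) (probability_setT m)).

Section kernel.
Context (P : R.-pker T ~> T).

Definition kernel_cons (x : T) : {measure set (n.+1.-tuple T) -> \bar R} :=
  law_cons (P x) k.

Let measurable_kernel_cons A : measurable A ->
  measurable_fun [set: T] (kernel_cons ^~ A).
Proof.
move=> mA; apply: measurable_fun_integral_kernel => //.
- by move=> U mU; exact: measurable_kernel.
- exact: measurable_fun_law_cons_section.
Qed.

HB.instance Definition _ :=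
  isKernel.Build _ _ _ _ _ kernel_cons measurable_kernel_cons.

Let kernel_consT x : kernel_cons x setT = 1.
Proof. by rewrite -(prob_kernel (s := P) x) -law_consT. Qed.

HB.instance Definition _ :=
  Kernel_isProbability.Build _ _ _ _ _ kernel_cons kernel_consT.

End kernel.
End law_cons.

Section markov_chain.
Context d (T : measurableType d) (R : realType).

(* Given X_t = x, the law of (X_(t+1), ..., X_(t+n)). *)
Fixpoint future (P : R.-pker T ~> T) n : R.-pker T ~> n.-tuple T :=
  if n is m.+1 then kernel_cons (future P m) P
  else kdirac (@measurable_cst _ _ T (0.-tuple T) setT [tuple]).

(* The law of the first n + 1 states of the chain with kernel P started
   from pi. *)
Definition chain_law (pi : probability T R) (P : R.-pker T ~> T) n :
    probability (n.+1.-tuple T) R :=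
  law_cons pi (future P n).

Definition stationary (pi : probability T R) (P : R.-pker T ~> T) :=
  forall A, measurable A -> \int[pi]_x P x A = pi A.

Definition empirical_mean (h : T -> R) n (x : n.+1.-tuple T) : R :=
  (n.+1%:R^-1 * \sum_(i < n.+1) h (tnth x i))%R.

(* A relation rather than a value in \bar R, since the limit need not exist;
   it is taken along the sample sizes n.+1. *)
Definition has_asymptotic_variance (pi : probability T R) (P : R.-pker T ~> T)
    (h : T -> R) (v : \bar R) :=
  n.+1%:R%:E * 'V_(chain_law pi P n)[@empirical_mean h n] @[n --> \oo] --> v.

Definition variance_bounding (pi : probability T R) (P : R.-pker T ~> T) :=
  forall h : T -> R, h \in Lfun pi 2%:E ->
    exists2 v, has_asymptotic_variance pi P h v & v < +oo.

End markov_chain.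

Section propose_accept_reject.
Context d (T : measurableType d) (R : realType).
Implicit Types mu : {measure set T -> \bar R}.

Definition is_pdf mu (f : T -> R) :=
  [/\ measurable_fun setT f, forall x, (0 <= f x)%R & \int[mu]_x (f x)%:E = 1].

Definition has_density mu (pi : probability T R) :=
  exists2 f, is_pdf mu f &
    forall A, measurable A -> pi A = \int[mu]_(x in A) (f x)%:E.

Definition mean_acceptance mu (q alpha : T -> T -> R) (x : T) : \bar R :=
  \int[mu]_y (q x y * alpha x y)%:E.

(* No joint measurability of q and alpha is assumed; the measurability of
   x |-> P x B is part of the type of P. *)
Definition propose_accept_reject mu (q alpha : T -> T -> R) (P : R.-pker T ~> T) :=
  [/\ forall x, is_pdf mu (q x),
      forall x, measurable_fun setT (alpha x),
      forall x y, (0 <= alpha x y <= 1)%R &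
      forall x B, measurable B ->
        P x B = \int[mu]_(y in B) (q x y * alpha x y)%:E
                + (1 - mean_acceptance mu q alpha x) * \d_x B].

End propose_accept_reject.

(* Main.v *)
(** Neither kernel need be reversible; everything goes through the conductance
    [inf { P(X_0 \in S, X_1 \notin S) / pi(S) | 0 < pi(S) <= 1/2 }]
    of the stationary chain.

    If [PA] is variance bounding its conductance is positive: otherwise there are
    sets [S k] that the chain started in [S k] rarely leaves during the first
    [N k] steps, with [N k] growing arbitrarily fast, and a gliding hump [h], a
    signed geometric series in the normalised indicators of the [S k], is square
    integrable while [Var (h(X_0) + ... + h(X_n)) / (n + 1)] is unbounded along
    [n = N k].

    With [eps] half the conductance of [PA], the overlap hypothesis gives
    [PA(x, ~S) <= eps + PB(x, ~S) / delta] for almost all [x \in S], so that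
    [PB] has positive conductance.

    Cheeger's inequality only needs stationarity, and yields
    [<f, PB f> <= (1 - lam) <f, f>] for centred [f]. The lazy operator
    [L = (I + PB) / 2] is then a strict contraction of the centred functions, so
    [f = (I - PB) (\sum_k L^k f / 2)]. Applying this twice writes the
    autocovariances as second differences [u k - 2 u(k+1) + u(k+2)] of a bounded
    sequence, and the variance of [f(X_0) + ... + f(X_n)] becomes an affine
    function of [n] up to a bounded error. *)

Require Import Defs.
From HB Require Import structures.
From mathcomp Require Import all_boot all_order all_algebra.
From mathcomp Require Import all_classical all_reals all_analysis.
From mathcomp Require Import measurable_realfun.
From mathcomp Require Import ring lra zify.

Set Implicit Arguments.
Unset Strict Implicit.
Unset Printing Implicit Defensive.
Import Order.TTheory GRing.Theory Num.Theory.
Import numFieldNormedType.Exports.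

Local Open Scope classical_set_scope.
Local Open Scope ring_scope.
Local Open Scope ereal_scope.

(** * Integrals against the law of a chain *)

Lemma cvg_ge0_integral_nd d (T : measurableType d) (R : realType)
    (mu : {measure set T -> \bar R}) (g : nat -> T -> \bar R) (f : T -> \bar R) :
  (forall n, measurable_fun setT (g n)) -> (forall n x, 0 <= g n x) ->
  (forall x, nondecreasing_seq (g ^~ x)) ->
  (forall x, g n x @[n --> \oo] --> f x) ->
  \int[mu]_x g n x @[n --> \oo] --> \int[mu]_x f x.
Proof.
move=> mg g0 ndg gf.
have -> : \int[mu]_x f x = \int[mu]_x limn (g ^~ x).
  by apply: eq_integral => x _; apply/esym/cvg_lim => //; exact: gf.
by apply: cvg_monotone_convergence => //= x _; exact: ndg.
Qed.

(** * Integration against a mixture of image measures *)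

Section mixture.
Context d1 d2 d3 (Y : measurableType d1) (W : measurableType d2)
  (Z : measurableType d3) (R : realType).
Variables (l : {measure set Y -> \bar R}) (m : {measure set Z -> \bar R})
  (k : Y -> {measure set W -> \bar R}) (phi : Y -> W -> Z).
Hypothesis mphi : forall y, measurable_fun setT (phi y).
Hypothesis mk : forall A, measurable A ->
  measurable_fun setT (fun y => k y (phi y @^-1` A)).
Hypothesis mE : forall A, measurable A -> m A = \int[l]_y k y (phi y @^-1` A).

Let mphi_preimage y A : measurable A -> measurable (phi y @^-1` A).
Proof. by move=> mA; rewrite -[X in measurable X]setTI; exact: mphi. Qed.

Import HBNNSimple.

Let section_indic (f : {nnsfun Z >-> R}) r y :
  \int[k y]_t (r * \1_(f @^-1` [set r]) (phi y t))%:E =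
  r%:E * k y (phi y @^-1` (f @^-1` [set r])).
Proof.
have mfr : measurable (f @^-1` [set r]) by exact: measurable_funPTI.
under eq_integral do rewrite EFinM.
have [r0|r0] := leP 0%R r.
  rewrite ge0_integralZl//.
    by rewrite integral_indic ?setIT//; exact: mphi_preimage.
  by apply/measurable_EFinP; exact: measurableT_comp.
(* A nonnegative simple function has empty level sets at negative values, so both sides vanish. *)
rewrite preimage_nnfun0// preimage_set0 measure0 mule0 integral0_eq// => t _.
by rewrite indic0 mule0.
Qed.

Let section_nnsfun (f : {nnsfun Z >-> R}) y :
  \int[k y]_t (f (phi y t))%:E =
  \sum_(r \in range f) r%:E * k y (phi y @^-1` (f @^-1` [set r])).
Proof.
under eq_integral do rewrite fimfunE -fsumEFin//.
rewrite ge0_integral_fsum//; last 2 first.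
  - move=> r; apply/measurable_EFinP; apply: measurable_funM => //.
    by apply: measurableT_comp => //; exact: measurable_indic.
  - by move=> r t _; rewrite EFinM nnfun_muleindic_ge0.
by apply: eq_fsbigr => r _; exact: section_indic.
Qed.

Let range_ge0 (f : {nnsfun Z >-> R}) r y :
  0 <= r%:E * k y (phi y @^-1` (f @^-1` [set r])).
Proof.
have [r0|r0] := leP 0%R r; first by rewrite mule_ge0.
by rewrite preimage_nnfun0// preimage_set0 measure0 mule0.
Qed.

Let measurable_section_level (f : {nnsfun Z >-> R}) r :
  measurable_fun setT (fun y => r%:E * k y (phi y @^-1` (f @^-1` [set r]))).
Proof. by apply: measurable_funeM; apply: mk; exact: measurable_funPTI. Qed.

Let measurable_section_nnsfun (f : {nnsfun Z >-> R}) :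
  measurable_fun setT (fun y => \int[k y]_t (f (phi y t))%:E).
Proof.
rewrite (_ : (fun y => _) = fun y => \sum_(r \in range f)
    r%:E * k y (phi y @^-1` (f @^-1` [set r]))).
  by apply: emeasurable_fsum => // r; exact: measurable_section_level.
by apply/funext => y; exact: section_nnsfun.
Qed.

Let integral_nnsfun_mixture (f : {nnsfun Z >-> R}) :
  \int[m]_z (f z)%:E = \int[l]_y \int[k y]_t (f (phi y t))%:E.
Proof.
under [RHS]eq_integral do rewrite section_nnsfun.
rewrite ge0_integral_fsum//.
under [LHS]eq_integral do rewrite fimfunE -fsumEFin//.
rewrite ge0_integral_fsum//; last 2 first.
  - by move=> r; exact/measurable_EFinP/measurableT_comp.
  - by move=> r z _; rewrite EFinM nnfun_muleindic_ge0.
apply: eq_fsbigr => r _.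
have mfr : measurable (f @^-1` [set r]) by exact: measurable_funPTI.
have [r0|r0] := leP 0%R r; last first.
  rewrite !integral0_eq// => y _.
    by rewrite preimage_nnfun0// preimage_set0 measure0 mule0.
  by rewrite preimage_nnfun0// indic0 mulr0.
rewrite ge0_integralZl//; last exact: mk.
under eq_integral do rewrite EFinM.
rewrite ge0_integralZl//; last first.
  by apply/measurable_EFinP; exact: measurable_indic.
by rewrite integral_indic// setIT mE.
Qed.

Variable f : Z -> \bar R.
Hypothesis (f0 : forall z, 0 <= f z) (mf : measurable_fun setT f).

Let f_ := nnsfun_approx measurableT mf.

Let section_approx y :
  \int[k y]_t (f_ n (phi y t))%:E @[n --> \oo] --> \int[k y]_t f (phi y t).
Proof.
apply: (cvg_ge0_integral_nd (g := fun n t => (f_ n (phi y t))%:E)).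
- move=> n; apply/measurable_EFinP.
  by apply: measurableT_comp => //; exact: mphi.
- by move=> n t; rewrite lee_fin.
- by move=> t a b ab; rewrite lee_fin; exact/lefP/nd_nnsfun_approx.
- by move=> t; exact: cvg_nnsfun_approx.
Qed.

Lemma measurable_fun_mixture :
  measurable_fun setT (fun y => \int[k y]_t f (phi y t)).
Proof.
apply: (emeasurable_fun_cvg
  (fun n y => \int[k y]_t (f_ n (phi y t))%:E)) => //.
Qed.

(** Linearity reduces the identity to the level sets of a simple function, where it is [mE];
    monotone convergence along [nnsfun_approx] does the rest. It is used with [phi y t = y :: t],
    which unfolds a chain law by one step, and with [phi y = id], which is stationarity. *)
Lemma ge0_integral_mixture :
  \int[m]_z f z = \int[l]_y \int[k y]_t f (phi y t).
Proof.
have h1 : \int[m]_z (f_ n z)%:E @[n --> \oo] --> \int[m]_z f z.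
  apply: (cvg_ge0_integral_nd (g := fun n z => (f_ n z)%:E)).
  - by move=> n; exact/measurable_EFinP.
  - by move=> n t; rewrite lee_fin.
  - by move=> t a b ab; rewrite lee_fin; exact/lefP/nd_nnsfun_approx.
  - by move=> t; exact: cvg_nnsfun_approx.
have h2 : \int[l]_y \int[k y]_t (f_ n (phi y t))%:E @[n --> \oo] -->
    \int[l]_y \int[k y]_t f (phi y t).
  apply: (cvg_ge0_integral_nd
    (g := fun n y => \int[k y]_t (f_ n (phi y t))%:E)) => //.
  - by move=> n y; apply: integral_ge0 => t _; rewrite lee_fin.
  - move=> y a b ab; apply: ge0_le_integral => //.
    + by move=> t _; rewrite lee_fin.
    + by apply/measurable_EFinP; apply: measurableT_comp => //; exact: mphi.
    + by apply/measurable_EFinP; apply: measurableT_comp => //; exact: mphi.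
    + by move=> t _; rewrite lee_fin; exact/lefP/nd_nnsfun_approx.
rewrite -(cvg_lim _ h1)// -(cvg_lim _ h2)//; congr (limn _).
by apply/funext => n; exact: integral_nnsfun_mixture.
Qed.

End mixture.

Section law_cons_integral.
Context d (T : measurableType d) (R : realType) (n : nat).
Variables (k : R.-pker T ~> n.-tuple T).

Lemma measurable_tuple_cons (y : T) :
  measurable_fun setT (fun t : n.-tuple T => [tuple of y :: t]).
Proof.
exact: (@measurable_cons _ _ (n.-tuple T) T (cst y) n id).
Qed.

Lemma ge0_integral_law_cons (m : {measure set T -> \bar R})
    (f : n.+1.-tuple T -> \bar R) :
  (forall z, 0 <= f z) -> measurable_fun setT f ->
  \int[law_cons m k]_z f z = \int[m]_y \int[k y]_t f [tuple of y :: t].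
Proof.
move=> f0 mf; apply: (@ge0_integral_mixture _ _ _ _ _ _ _ _ _ k
  (fun y (t : n.-tuple T) => [tuple of y :: t])) => //.
- by move=> y; exact: measurable_tuple_cons.
- by move=> A mA; exact: measurable_fun_law_cons_section.
Qed.

Lemma measurable_fun_law_cons (f : n.+1.-tuple T -> \bar R) :
  (forall z, 0 <= f z) -> measurable_fun setT f ->
  measurable_fun setT (fun y => \int[k y]_t f [tuple of y :: t]).
Proof.
move=> f0 mf; apply: (@measurable_fun_mixture _ _ _ _ _ _ _ k
  (fun y (t : n.-tuple T) => [tuple of y :: t])) => //.
- by move=> y; exact: measurable_tuple_cons.
- by move=> A mA; exact: measurable_fun_law_cons_section.
Qed.

End law_cons_integral.

(** * The action of a kernel on nonnegative functions *)

Section kernel_operator.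
Context d (T : measurableType d) (R : realType) (P : R.-pker T ~> T).
Implicit Types f g : T -> \bar R.

Definition kernel_operator f x := \int[P x]_y f y.

Lemma kernel_operator_ge0 f : (forall x, 0 <= f x) ->
  forall x, 0 <= kernel_operator f x.
Proof. by move=> f0 x; exact: integral_ge0. Qed.

Lemma measurable_kernel_operator f : (forall x, 0 <= f x) ->
  measurable_fun setT f -> measurable_fun setT (kernel_operator f).
Proof.
by move=> f0 mf; apply: measurable_fun_integral_kernel => // U mU;
  exact: measurable_kernel.
Qed.

(** By induction on the length: the tail of the future is the future of its own first state.
    Coordinate [i] of the future is the state at time [i + 1], hence [iter i.+1]. *)
Lemma integral_future n (i : 'I_n) f y : (forall x, 0 <= f x) ->
  measurable_fun setT f ->
  \int[future P n y]_t f (tnth t i) = iter i.+1 kernel_operator f y.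
Proof.
move=> f0 mf; elim: n i y => [[]//|n IH] i y /=.
have mfi : measurable_fun setT (fun t : n.+1.-tuple T => f (tnth t i)).
  by apply: measurableT_comp => //; exact: measurable_tnth.
rewrite /kernel_cons ge0_integral_law_cons//.
case: (unliftP ord0 i) => [j ->|->].
- under eq_integral => z _.
    under eq_integral => t _ do rewrite tnthS.
    over.
  apply: eq_integral => z _; rewrite IH.
  by rewrite lift0.
- under eq_integral => z _.
    under eq_integral => t _ do rewrite tnth0.
    rewrite integral_cst// prob_kernel mule1; over.
  by [].
Qed.

End kernel_operator.

(** * Joint laws of a stationary chain *)

Section stationary_chain.
Context d (T : measurableType d) (R : realType) (pi : probability T R)
  (P : R.-pker T ~> T).
Hypothesis piP : stationary pi P.
Implicit Types f g : T -> \bar R.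

Lemma integral_kernel_operator f : (forall x, 0 <= f x) ->
  measurable_fun setT f -> \int[pi]_x kernel_operator P f x = \int[pi]_x f x.
Proof.
move=> f0 mf; apply/esym.
apply: (@ge0_integral_mixture _ _ _ _ _ _ _ _ _ P (fun _ => id)) => //.
- by move=> A mA; exact: measurable_kernel.
- by move=> A mA; exact/esym/piP.
Qed.

(** Shift invariance: under stationarity the second state again has law [pi], so forgetting the
    first one leaves a shorter chain of the same kind. *)
Lemma integral_chain_behead n (f : n.+1.-tuple T -> \bar R) :
  (forall x, 0 <= f x) -> measurable_fun setT f ->
  \int[chain_law pi P n.+1]_x f [tuple of behead x] =
  \int[chain_law pi P n]_x f x.
Proof.
move=> f0 mf; rewrite /chain_law [RHS]ge0_integral_law_cons//.
rewrite ge0_integral_law_cons//; last first.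
  by apply: measurableT_comp => //; exact: measurable_behead.
rewrite -[RHS]integral_kernel_operator//; last 2 first.
  by move=> x; exact: integral_ge0.
  exact: measurable_fun_law_cons.
apply: eq_integral => y _.
rewrite /kernel_operator -ge0_integral_law_cons//.
by apply: eq_integral => t _; congr f; exact: val_inj.
Qed.

(** If both indices are positive, shift invariance lowers them together; if [i = 0], conditioning on
    the initial state reduces to [integral_future]. *)
Lemma integral_chain_pair n (i j : 'I_n.+1) f g : (i <= j)%N ->
  (forall x, 0 <= f x) -> measurable_fun setT f ->
  (forall x, 0 <= g x) -> measurable_fun setT g ->
  \int[chain_law pi P n]_x (f (tnth x i) * g (tnth x j)) =
  \int[pi]_x (f x * iter (j - i) (kernel_operator P) g x).
Proof.
move=> + f0 mf g0 mg; elim: n i j => [|n IH] i j.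
  rewrite !ord1 => _ /=; rewrite /chain_law ge0_integral_law_cons//; last 2 first.
    by move=> x; rewrite mule_ge0.
    by apply: emeasurable_funM; apply: measurableT_comp => //;
      exact: measurable_tnth.
  apply: eq_integral => y _.
  under eq_integral do rewrite tnth0.
  by rewrite integral_cst// prob_kernel mule1.
case: (unliftP ord0 i) => [i' ->|->]; case: (unliftP ord0 j) => [j' ->|->] //.
- rewrite !lift0 ltnS subSS => ij; rewrite -IH//.
  rewrite -[RHS]integral_chain_behead//; last 2 first.
    by move=> x; rewrite mule_ge0.
    by apply: emeasurable_funM; apply: measurableT_comp => //;
      exact: measurable_tnth.
  apply: eq_integral => x _; case/tupleP: x => y t.
  have -> : [tuple of behead [tuple of y :: t]] = t by exact: val_inj.
  by rewrite !tnthS.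
- rewrite lift0 subn0 => _ /=.
  rewrite /chain_law ge0_integral_law_cons//; last 2 first.
    by move=> x; rewrite mule_ge0.
    by apply: emeasurable_funM; apply: measurableT_comp => //;
      exact: measurable_tnth.
  apply: eq_integral => y _.
  under eq_integral do rewrite tnth0 tnthS.
  rewrite ge0_integralZl//.
    by rewrite integral_future.
  by apply: measurableT_comp => //; exact: measurable_tnth.
- rewrite subnn => _ /=.
  rewrite /chain_law ge0_integral_law_cons//; last 2 first.
    by move=> x; rewrite mule_ge0.
    by apply: emeasurable_funM; apply: measurableT_comp => //;
      exact: measurable_tnth.
  apply: eq_integral => y _.
  under eq_integral do rewrite tnth0.
  by rewrite integral_cst// prob_kernel mule1.
Qed.

Lemma integral_chain_coord n (i : 'I_n.+1) f :
  (forall x, 0 <= f x) -> measurable_fun setT f ->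
  \int[chain_law pi P n]_x f (tnth x i) = \int[pi]_x f x.
Proof.
move=> f0 mf; have := @integral_chain_pair n i i f (cst 1) (leqnn _) f0 mf.
rewrite subnn /= => /(_ _ _)/=.
by under eq_integral do rewrite mule1; under [RHS]eq_integral do rewrite mule1; apply.
Qed.

End stationary_chain.

Local Open Scope ring_scope.

(** * Lagged covariances of a stationary chain *)

Section square_integrable.
Context d (T : measurableType d) (R : realType) (mu : {finite_measure set T -> \bar R}).
Implicit Types f g : T -> R.

Lemma Lfun2P f : f \in Lfun mu 2%:E <->
  measurable_fun setT f /\ (\int[mu]_x (f x ^+ 2)%:E < +oo)%E.
Proof.
split=> [f2|[mf foo]].
  split; first by move: f2; rewrite inE => /andP[]; rewrite inE.
  exact/integrable_lty/Lfun2_integrable_sqr.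
rewrite inE; apply/andP; split; rewrite inE//= /finite_norm unlock /Lnorm.
apply: poweR_lty; under eq_integral do
  rewrite /= powR_mulrn// -normrX ger0_norm ?sqr_ge0//.
exact: foo.
Qed.

Lemma Lfun2_measurable f : f \in Lfun mu 2%:E -> measurable_fun setT f.
Proof. by move=> /Lfun2P[]. Qed.

Lemma Lfun2_le f g : measurable_fun setT f -> g \in Lfun mu 2%:E ->
  (forall x, f x ^+ 2 <= g x ^+ 2) -> f \in Lfun mu 2%:E.
Proof.
move=> mf /Lfun2P[mg goo] fg; apply/Lfun2P; split => //.
apply: le_lt_trans goo; apply: ge0_le_integral => //.
- by move=> x _; rewrite lee_fin sqr_ge0.
- by apply/measurable_EFinP; exact: measurable_funX.
- by apply/measurable_EFinP; exact: measurable_funX.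
- by move=> x _; rewrite lee_fin.
Qed.

Lemma Lfun2D f g : f \in Lfun mu 2%:E -> g \in Lfun mu 2%:E ->
  (fun x => f x + g x) \in Lfun mu 2%:E.
Proof. by move=> f2 g2; rewrite rpredD ?lee1n. Qed.

Lemma Lfun2B f g : f \in Lfun mu 2%:E -> g \in Lfun mu 2%:E ->
  (fun x => f x - g x) \in Lfun mu 2%:E.
Proof. by move=> f2 g2; rewrite rpredB ?lee1n. Qed.

Lemma Lfun2Z a f : f \in Lfun mu 2%:E -> (fun x => a * f x) \in Lfun mu 2%:E.
Proof.
move=> f2; rewrite (_ : (fun x => _) = a \o* f); last first.
  by apply/funext => x; rewrite /= mulrC.
by apply: Lfun_scale => //; rewrite ler1n.
Qed.

Lemma Lfun2_sum n (f : 'I_n -> T -> R) : (forall i, f i \in Lfun mu 2%:E) ->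
  (fun x => \sum_(i < n) f i x) \in Lfun mu 2%:E.
Proof.
move=> f2; elim: n f f2 => [|n IH] f f2.
  under eq_fun do rewrite big_ord0.
  exact: Lfun_cst.
under eq_fun do rewrite big_ord_recl.
by apply: Lfun2D => //; exact: IH.
Qed.

Lemma Lfun2_funrpos f : f \in Lfun mu 2%:E -> f^\+ \in Lfun mu 2%:E.
Proof.
move=> f2; apply: (Lfun2_le _ f2).
  by apply: measurable_funrpos; exact: Lfun2_measurable.
move=> x; rewrite /funrpos /=; case: (leP 0 (f x)) => [f0|f0].
  by [].
by rewrite expr0n sqr_ge0.
Qed.

Lemma Lfun2_funrneg f : f \in Lfun mu 2%:E -> f^\- \in Lfun mu 2%:E.
Proof.
move=> f2; rewrite -funrposN; apply: Lfun2_funrpos.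
by rewrite rpredN ?lee1n.
Qed.

Lemma Lfun2_integrableM f g : f \in Lfun mu 2%:E -> g \in Lfun mu 2%:E ->
  mu.-integrable setT (EFin \o (fun x => f x * g x)).
Proof. by move=> f2 g2; exact/Lfun1_integrable/Lfun2_mul_Lfun1. Qed.

Lemma Lfun2_integrable f : f \in Lfun mu 2%:E ->
  mu.-integrable setT (EFin \o f).
Proof.
move=> f2; apply/Lfun1_integrable; apply: Lfun_subset12 => //.
exact: fin_num_measure.
Qed.

Lemma integrable_EFinZl a f : mu.-integrable setT (EFin \o f) ->
  mu.-integrable setT (EFin \o (fun x => a * f x)).
Proof.
move=> fi; rewrite (_ : EFin \o _ = fun x => (a%:E * (EFin \o f) x)%E)//.
exact: integrableZl.
Qed.

Lemma integrable_EFinD f g : mu.-integrable setT (EFin \o f) ->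
  mu.-integrable setT (EFin \o g) ->
  mu.-integrable setT (EFin \o (fun x => f x + g x)).
Proof.
move=> fi gi; rewrite (_ : EFin \o _ = (EFin \o f) \+ (EFin \o g))%E//.
exact: integrableD.
Qed.

Lemma integrable_EFin_sum n (f : 'I_n -> T -> R) :
  (forall i, mu.-integrable setT (EFin \o f i)) ->
  mu.-integrable setT (EFin \o (fun x => \sum_(i < n) f i x)).
Proof.
move=> fi; rewrite (_ : EFin \o _ = fun x => \sum_(i < n) (f i x)%:E)%E.
  by apply: integrable_sum => // i _; exact: fi.
by apply/funext => x /=; rewrite sumEFin.
Qed.

Lemma Rintegral_sum n (f : 'I_n -> T -> R) :
  (forall i, mu.-integrable setT (EFin \o f i)) ->
  \int[mu]_x (\sum_(i < n) f i x) = \sum_(i < n) \int[mu]_x f i x.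
Proof.
move=> fi; rewrite /Rintegral.
under eq_integral do rewrite -sumEFin.
rewrite integral_sum// -sum_fine// => i _.
exact: (integrable_fin_num _ (fi i)).
Qed.

End square_integrable.

(** * The bilinear form of lagged products *)

Section lag_covariance.
Context d (T : measurableType d) (R : realType) (pi : probability T R)
  (P : R.-pker T ~> T).
Hypothesis piP : stationary pi P.
Implicit Types f g h : T -> R.

(** No mean is subtracted: this is the pairing of [f] with [P^k g] in L^2(pi), read off the joint
    law of the chain so that a signed [g] need not be integrable under every [P x]. *)
Definition lag_cov k f g : R :=
  \int[chain_law pi P k]_x (f (tnth x ord0) * g (tnth x ord_max)).

Lemma Lfun2_coord n (i : 'I_n.+1) f : f \in Lfun pi 2%:E ->
  (fun x => f (tnth x i)) \in Lfun (chain_law pi P n) 2%:E.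
Proof.
move=> /Lfun2P[mf foo]; apply/Lfun2P; split.
  by apply: measurableT_comp => //; exact: measurable_tnth.
rewrite (integral_chain_coord piP i (f := fun y => (f y ^+ 2)%:E))//.
  by move=> y; rewrite lee_fin sqr_ge0.
by apply/measurable_EFinP; exact: measurable_funX.
Qed.

Lemma integrable_coordM n (i j : 'I_n.+1) f g :
  f \in Lfun pi 2%:E -> g \in Lfun pi 2%:E ->
  (chain_law pi P n).-integrable setT
    (EFin \o (fun x => f (tnth x i) * g (tnth x j))).
Proof.
by move=> f2 g2; apply: Lfun2_integrableM; exact: Lfun2_coord.
Qed.

Lemma Rintegral_coordBl n (i j : 'I_n.+1) f f' g :
  f \in Lfun pi 2%:E -> f' \in Lfun pi 2%:E -> g \in Lfun pi 2%:E ->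
  \int[chain_law pi P n]_x ((f (tnth x i) - f' (tnth x i)) * g (tnth x j)) =
  \int[chain_law pi P n]_x (f (tnth x i) * g (tnth x j)) -
  \int[chain_law pi P n]_x (f' (tnth x i) * g (tnth x j)).
Proof.
move=> f2 f'2 g2; under eq_Rintegral do rewrite mulrBl.
by rewrite RintegralB//; exact: integrable_coordM.
Qed.

Lemma Rintegral_coordBr n (i j : 'I_n.+1) f g g' :
  f \in Lfun pi 2%:E -> g \in Lfun pi 2%:E -> g' \in Lfun pi 2%:E ->
  \int[chain_law pi P n]_x (f (tnth x i) * (g (tnth x j) - g' (tnth x j))) =
  \int[chain_law pi P n]_x (f (tnth x i) * g (tnth x j)) -
  \int[chain_law pi P n]_x (f (tnth x i) * g' (tnth x j)).
Proof.
move=> f2 g2 g'2; under eq_Rintegral do rewrite mulrBr.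
by rewrite RintegralB//; exact: integrable_coordM.
Qed.

Let posnegE f x : f x = f^\+ x - f^\- x.
Proof. by rewrite -[in LHS](funrposBneg f). Qed.

Let Rintegral_coord_posneg n (i j : 'I_n.+1) f g :
  f \in Lfun pi 2%:E -> g \in Lfun pi 2%:E ->
  \int[chain_law pi P n]_x (f (tnth x i) * g (tnth x j)) =
  \int[chain_law pi P n]_x (f^\+ (tnth x i) * g^\+ (tnth x j)) -
  \int[chain_law pi P n]_x (f^\+ (tnth x i) * g^\- (tnth x j)) -
  (\int[chain_law pi P n]_x (f^\- (tnth x i) * g^\+ (tnth x j)) -
   \int[chain_law pi P n]_x (f^\- (tnth x i) * g^\- (tnth x j))).
Proof.
move=> f2 g2; have := (Lfun2_funrpos f2, Lfun2_funrneg f2).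
have := (Lfun2_funrpos g2, Lfun2_funrneg g2) => -[gp gn] [fp fn].
rewrite -!Rintegral_coordBr//.
rewrite -(Rintegral_coordBl i j (g := fun y => g^\+ y - g^\- y))//; last first.
  exact: Lfun2B.
by apply: eq_Rintegral => x _; rewrite !(posnegE f) !(posnegE g).
Qed.

Let Rintegral_pair_ge0 n (i j : 'I_n.+1) f g : (i <= j)%N ->
  measurable_fun setT f -> measurable_fun setT g ->
  (forall x, 0 <= f x) -> (forall x, 0 <= g x) ->
  \int[chain_law pi P n]_x (f (tnth x i) * g (tnth x j)) =
  fine (\int[pi]_x ((f x)%:E *
    iter (j - i) (kernel_operator P) (EFin \o g) x))%E.
Proof.
move=> ij mf mg f0 g0; rewrite /Rintegral; congr fine.
rewrite -(integral_chain_pair piP)//; first exact/measurable_EFinP.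
exact/measurable_EFinP.
Qed.

(** The formula for pairs of coordinates covers nonnegative functions, so both arguments are split
    into positive and negative parts; each of the four products then depends on [j - i] alone. *)
Lemma Rintegral_pair n (i j : 'I_n.+1) f g : (i <= j)%N ->
  f \in Lfun pi 2%:E -> g \in Lfun pi 2%:E ->
  \int[chain_law pi P n]_x (f (tnth x i) * g (tnth x j)) = lag_cov (j - i) f g.
Proof.
move=> ij f2 g2; rewrite /lag_cov (Rintegral_coord_posneg i j f2 g2).
rewrite (Rintegral_coord_posneg ord0 ord_max f2 g2).
have mfp := Lfun2_measurable (Lfun2_funrpos f2).
have mfn := Lfun2_measurable (Lfun2_funrneg f2).
have mgp := Lfun2_measurable (Lfun2_funrpos g2).
have mgn := Lfun2_measurable (Lfun2_funrneg g2).
have e (u v : T -> R) : measurable_fun setT u -> measurable_fun setT v ->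
    (forall x, 0 <= u x) -> (forall x, 0 <= v x) ->
    \int[chain_law pi P n]_x (u (tnth x i) * v (tnth x j)) =
    \int[chain_law pi P (j - i)]_x (u (tnth x ord0) * v (tnth x ord_max)).
  by move=> mu mv u0 v0; rewrite !Rintegral_pair_ge0//= subn0.
by rewrite !e.
Qed.

Lemma lag_covBl k f f' g :
  f \in Lfun pi 2%:E -> f' \in Lfun pi 2%:E -> g \in Lfun pi 2%:E ->
  lag_cov k (fun x => f x - f' x) g = lag_cov k f g - lag_cov k f' g.
Proof. exact: Rintegral_coordBl. Qed.

Lemma lag_covBr k f g g' :
  f \in Lfun pi 2%:E -> g \in Lfun pi 2%:E -> g' \in Lfun pi 2%:E ->
  lag_cov k f (fun x => g x - g' x) = lag_cov k f g - lag_cov k f g'.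
Proof. exact: Rintegral_coordBr. Qed.

Lemma lag_covDl k f f' g :
  f \in Lfun pi 2%:E -> f' \in Lfun pi 2%:E -> g \in Lfun pi 2%:E ->
  lag_cov k (fun x => f x + f' x) g = lag_cov k f g + lag_cov k f' g.
Proof.
move=> f2 f'2 g2; rewrite /lag_cov.
under eq_Rintegral do rewrite mulrDl.
by rewrite RintegralD//; exact: integrable_coordM.
Qed.

Lemma lag_covDr k f g g' :
  f \in Lfun pi 2%:E -> g \in Lfun pi 2%:E -> g' \in Lfun pi 2%:E ->
  lag_cov k f (fun x => g x + g' x) = lag_cov k f g + lag_cov k f g'.
Proof.
move=> f2 g2 g'2; rewrite /lag_cov.
under eq_Rintegral do rewrite mulrDr.
by rewrite RintegralD//; exact: integrable_coordM.
Qed.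

Lemma lag_covZl k a f g : f \in Lfun pi 2%:E -> g \in Lfun pi 2%:E ->
  lag_cov k (fun x => a * f x) g = a * lag_cov k f g.
Proof.
move=> f2 g2; rewrite /lag_cov.
under eq_Rintegral do rewrite -mulrA.
by rewrite RintegralZl//; exact: integrable_coordM.
Qed.

Lemma lag_covZr k a f g : f \in Lfun pi 2%:E -> g \in Lfun pi 2%:E ->
  lag_cov k f (fun x => a * g x) = a * lag_cov k f g.
Proof.
move=> f2 g2; rewrite /lag_cov.
under eq_Rintegral do rewrite mulrCA.
by rewrite RintegralZl//; exact: integrable_coordM.
Qed.

Lemma lag_cov0C f g : lag_cov 0 f g = lag_cov 0 g f.
Proof.
by rewrite /lag_cov; apply: eq_Rintegral => x _; rewrite !ord1 mulrC.
Qed.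

Lemma lag_cov_ge0 k f g : (forall x, 0 <= f x) -> (forall x, 0 <= g x) ->
  0 <= lag_cov k f g.
Proof. by move=> f0 g0; apply: Rintegral_ge0 => x _; rewrite mulr_ge0. Qed.

Lemma lag_cov0_ge0 f : 0 <= lag_cov 0 f f.
Proof. by apply: Rintegral_ge0 => x _; rewrite !ord1 -expr2 sqr_ge0. Qed.

(** By stationarity the two squares in the expansion have the same integrals as at lag 0. *)
Lemma lag_cov_sqrD k f g a b : f \in Lfun pi 2%:E -> g \in Lfun pi 2%:E ->
  \int[chain_law pi P k]_x (a * f (tnth x ord0) + b * g (tnth x ord_max)) ^+ 2 =
  a ^+ 2 * lag_cov 0 f f + 2 * a * b * lag_cov k f g + b ^+ 2 * lag_cov 0 g g.
Proof.
move=> f2 g2.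
have -> : lag_cov 0 f f = \int[chain_law pi P k]_x
    (f (tnth x ord0) * f (tnth x ord0)) by rewrite Rintegral_pair.
have -> : lag_cov 0 g g = \int[chain_law pi P k]_x
    (g (tnth x ord_max) * g (tnth x ord_max)) by rewrite Rintegral_pair// subnn.
rewrite /lag_cov -!RintegralZl//; try exact: integrable_coordM.
have fgi (i j : 'I_k.+1) u v c : u \in Lfun pi 2%:E -> v \in Lfun pi 2%:E ->
    (chain_law pi P k).-integrable setT
      (EFin \o (fun x => c * (u (tnth x i) * v (tnth x j)))).
  by move=> u2 v2; apply: integrable_EFinZl; exact: integrable_coordM.
rewrite -!RintegralD//; try exact: fgi; last by apply: integrable_EFinD; exact: fgi.
by apply: eq_Rintegral => x _; ring.
Qed.

(** The square in [lag_cov_sqrD] is nonnegative for the weight [b] and for [- b], which bounds both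
    signs of the cross term. *)
Lemma lag_cov_young k f g a b : f \in Lfun pi 2%:E -> g \in Lfun pi 2%:E ->
  2 * a * b * `|lag_cov k f g| <= a ^+ 2 * lag_cov 0 f f + b ^+ 2 * lag_cov 0 g g.
Proof.
move=> f2 g2.
have p := lag_cov_sqrD k a b f2 g2.
have m := lag_cov_sqrD k a (- b) f2 g2.
have p0 : 0 <= \int[chain_law pi P k]_x
    (a * f (tnth x ord0) + b * g (tnth x ord_max)) ^+ 2.
  by apply: Rintegral_ge0 => x _; exact: sqr_ge0.
have m0 : 0 <= \int[chain_law pi P k]_x
    (a * f (tnth x ord0) + - b * g (tnth x ord_max)) ^+ 2.
  by apply: Rintegral_ge0 => x _; exact: sqr_ge0.
rewrite {}p in p0; rewrite {}m sqrrN mulrN mulNr in m0.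
by case: (ger0P (lag_cov k f g)) => _; lra.
Qed.

End lag_covariance.

(** * Second moments of partial sums along the chain *)

Section chain_sums.
Context d (T : measurableType d) (R : realType) (pi : probability T R)
  (P : R.-pker T ~> T).
Hypothesis piP : stationary pi P.
Implicit Types f g h : T -> R.

Definition chain_sum_sq n f : R :=
  \int[chain_law pi P n]_x (\sum_(i < n.+1) f (tnth x i)) ^+ 2.

Lemma chain_sum_sq_ge0 n f : 0 <= chain_sum_sq n f.
Proof. by apply: Rintegral_ge0 => x _; exact: sqr_ge0. Qed.

Let Lfun2_chain_sum n f : f \in Lfun pi 2%:E ->
  (fun x => \sum_(i < n.+1) f (tnth x i)) \in Lfun (chain_law pi P n) 2%:E.
Proof. by move=> f2; apply: Lfun2_sum => i; exact: Lfun2_coord. Qed.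

Let integrable_sum_sq n f : f \in Lfun pi 2%:E ->
  (chain_law pi P n).-integrable setT
    (EFin \o (fun x => (\sum_(i < n.+1) f (tnth x i)) ^+ 2)).
Proof. by move=> f2; apply: Lfun2_integrable_sqr; exact: Lfun2_chain_sum. Qed.

(** With truncated subtraction, [(i - j) + (j - i)] is the distance between the times [i] and
    [j]. *)
Lemma chain_sum_sqE n f : f \in Lfun pi 2%:E -> chain_sum_sq n f =
  \sum_(i < n.+1) \sum_(j < n.+1) lag_cov pi P ((i - j) + (j - i)) f f.
Proof.
move=> f2; rewrite /chain_sum_sq.
under eq_Rintegral do rewrite expr2 big_distrlr/=.
rewrite Rintegral_sum; last first.
  by move=> i; apply: integrable_EFin_sum => j; exact: integrable_coordM.
apply: eq_bigr => i _; rewrite Rintegral_sum; last first.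
  by move=> j; exact: integrable_coordM.
apply: eq_bigr => j _; have [ij|/ltnW ji] := leqP i j.
  by rewrite Rintegral_pair//; congr lag_cov; move/eqP: ij => ->.
under eq_Rintegral do rewrite mulrC.
by rewrite Rintegral_pair//; congr lag_cov; move/eqP: ji => ->; rewrite addn0.
Qed.

Lemma lag_cov_le k f : f \in Lfun pi 2%:E ->
  `|lag_cov pi P k f f| <= lag_cov pi P 0 f f.
Proof.
by move=> f2; have := lag_cov_young piP k 1 1 f2 f2; rewrite expr1n; lra.
Qed.

Lemma chain_sum_sq_le n f : f \in Lfun pi 2%:E ->
  chain_sum_sq n f <= n.+1%:R ^+ 2 * lag_cov pi P 0 f f.
Proof.
move=> f2; rewrite chain_sum_sqE//.
apply: (@le_trans _ _ (\sum_(i < n.+1) \sum_(j < n.+1) lag_cov pi P 0 f f)).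
  apply: ler_sum => i _; apply: ler_sum => j _.
  exact/(le_trans (ler_norm _))/lag_cov_le.
by rewrite !sumr_const !card_ord expr2 -mulrA !mulr_natl.
Qed.

Lemma chain_sum_sq_parallelogram n f g : f \in Lfun pi 2%:E ->
  g \in Lfun pi 2%:E ->
  chain_sum_sq n (fun x => f x + g x) + chain_sum_sq n (fun x => f x - g x) =
  2 * chain_sum_sq n f + 2 * chain_sum_sq n g.
Proof.
move=> f2 g2; rewrite /chain_sum_sq -!RintegralZl//; try exact: integrable_sum_sq.
rewrite -!RintegralD//; try by apply: integrable_EFinZl; exact: integrable_sum_sq.
- by apply: eq_Rintegral => x _; rewrite big_split sumrB/=; ring.
- exact: (integrable_sum_sq n (Lfun2D f2 g2)).
- exact: (integrable_sum_sq n (Lfun2B f2 g2)).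
Qed.

(** The parallelogram identity for [g] and [f - g], with its nonnegative second term dropped. *)
Lemma chain_sum_sq_triangle n f g : f \in Lfun pi 2%:E -> g \in Lfun pi 2%:E ->
  chain_sum_sq n f <=
  2 * chain_sum_sq n g + 2 * chain_sum_sq n (fun x => f x - g x).
Proof.
move=> f2 g2; rewrite -chain_sum_sq_parallelogram//; last exact: Lfun2B.
under [X in chain_sum_sq n X + _]eq_fun do rewrite subrKC.
by rewrite lerDl chain_sum_sq_ge0.
Qed.

Lemma chain_sum_sqZ n a f : f \in Lfun pi 2%:E ->
  chain_sum_sq n (fun x => a * f x) = a ^+ 2 * chain_sum_sq n f.
Proof.
move=> f2; rewrite /chain_sum_sq -RintegralZl//; last exact: integrable_sum_sq.
by apply: eq_Rintegral => x _; rewrite -mulr_sumr exprMn.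
Qed.

Lemma Rintegral_coord n (i : 'I_n.+1) f : measurable_fun setT f ->
  \int[chain_law pi P n]_x f (tnth x i) = \int[pi]_x f x.
Proof.
move=> mf; rewrite /Rintegral; congr fine.
rewrite integralE [RHS]integralE -!(integral_chain_coord piP i)//.
- by congr (_ - _)%E; apply: eq_integral => x _; rewrite ?funeposE ?funenegE.
- by apply: measurable_funeneg; exact/measurable_EFinP.
- by apply: measurable_funepos; exact/measurable_EFinP.
Qed.

Let expectation_Rintegral n (X : n.+1.-tuple T -> R) :
  (chain_law pi P n).-integrable setT (EFin \o X) ->
  'E_(chain_law pi P n)[X] = (\int[chain_law pi P n]_x X x)%:E.
Proof.
by move=> iX; rewrite unlock /Rintegral fineK//; exact: integrable_fin_num iX.
Qed.

Lemma variance_empirical_mean n h : h \in Lfun pi 2%:E ->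
  (n.+1%:R%:E * 'V_(chain_law pi P n)[@empirical_mean _ _ _ h n])%E =
  (chain_sum_sq n (fun x => (h x - \int[pi]_y h y)%R) / n.+1%:R)%:E.
Proof.
move=> h2; set m := \int[pi]_y h y.
have Em : 'E_(chain_law pi P n)[@empirical_mean _ _ _ h n] = m%:E.
  rewrite expectation_Rintegral; last first.
    apply: integrable_EFinZl; apply: Lfun2_integrable; exact: Lfun2_chain_sum.
  congr EFin; rewrite /empirical_mean RintegralZl//; last first.
    apply: Lfun2_integrable; exact: Lfun2_chain_sum.
  rewrite Rintegral_sum; last first.
    by move=> i; apply: Lfun2_integrable; exact: Lfun2_coord.
  under eq_bigr do rewrite (Rintegral_coord _ (Lfun2_measurable h2)).
  by rewrite sumr_const card_ord -(mulr_natl m) mulKf ?pnatr_eq0.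
have hm2 : (fun x => h x - m) \in Lfun pi 2%:E.
  by apply: Lfun2B => //; exact: Lfun_cst.
rewrite /variance covariance.unlock Em /=.
rewrite (_ : _ * _ = fun x => n.+1%:R ^- 2 *
    (\sum_(i < n.+1) (h (tnth x i) - m)) ^+ 2); last first.
  apply/funext => x; rewrite !fctE /= sumrB sumr_const card_ord.
  rewrite /empirical_mean -(mulr_natl m); field.
  by rewrite nat1r pnatr_eq0.
rewrite expectation_Rintegral; last first.
  by apply: integrable_EFinZl; exact: (integrable_sum_sq n hm2).
rewrite RintegralZl//; last exact: (integrable_sum_sq n hm2).
by rewrite -EFinM; congr EFin; rewrite /chain_sum_sq; field.
Qed.

End chain_sums.

(** * A spectral gap bounds the variance *)

Section second_difference.
Context (R : realType).
Implicit Types (u : nat -> R) (c : nat -> nat -> R).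

Lemma sum_second_difference u n (c := fun k => u k - 2 * u k.+1 + u k.+2) :
  \sum_(i < n) c i.+1 = (u 1 - u 2) - (u n.+1 - u n.+2).
Proof.
elim: n => [|n IH]; first by rewrite big_ord0 subrr.
by rewrite big_ord_recr /= IH /c; ring.
Qed.

(** Enlarging the square of indices adds a corner at distance 0, and a row and a column that each
    run through the distances 1 to [n]. *)
Lemma sum_dist_recr (c : nat -> R) n :
  \sum_(i < n.+1) \sum_(j < n.+1) c ((i - j) + (j - i))%N =
  \sum_(i < n) \sum_(j < n) c ((i - j) + (j - i))%N + c 0%N +
  2 * \sum_(i < n) c i.+1.
Proof.
have e1 : \sum_(i < n) c ((i - n) + (n - i))%N = \sum_(i < n) c i.+1.
  rewrite (reindex_inj rev_ord_inj)/=; apply: eq_bigr => i _.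
  by congr c; have := ltn_ord i; lia.
have e2 : \sum_(j < n) c ((n - j) + (j - n))%N = \sum_(i < n) c i.+1.
  by rewrite -e1; apply: eq_bigr => i _; rewrite addnC.
rewrite big_ord_recr /= [X in _ + X]big_ord_recr /= subnn addn0 e2.
under eq_bigr do rewrite big_ord_recr /=.
by rewrite big_split /= e1; ring.
Qed.

(** Going from [n] to [n + 1] adds the slope minus [2 * (u n.+1 - u n.+2)], and the latter
    telescopes. For bounded [u] only the slope survives division by [n]. *)
Lemma sum_dist_second_difference u n
    (c := fun k => u k - 2 * u k.+1 + u k.+2) :
  \sum_(i < n) \sum_(j < n) c ((i - j) + (j - i))%N =
  n%:R * (c 0%N + 2 * (u 1%N - u 2%N)) - 2 * (u 1%N - u n.+1).
Proof.
elim: n => [|n IH]; first by rewrite big_ord0; ring.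
rewrite sum_dist_recr IH sum_second_difference -natr1; ring.
Qed.

(** Abstracts [c j k = E[f(X_0) (L^k f)(X_j)]] for the lazy operator [L = (I + P) / 2]: the bound
    expresses that [L] contracts, the recurrence is the definition of [L]. *)
Definition geometric_averaging (M r : R) c :=
  (forall j k, `|c j k| <= M * r ^+ k) /\
  (forall j k, c j k.+1 = (c j k + c j.+1 k) / 2).

(** As [I - P = 2 (I - L)], half the Neumann series of [L] inverts [I - P]. In coordinates, [G j k]
    is half the sum over [l] of [c j (k + l)], and the geometric bound makes it converge. *)
Lemma geometric_averaging_potential M r c : 0 <= r < 1 ->
  geometric_averaging M r c ->
  exists M' G, geometric_averaging M' r G /\
    forall j k, c j k = G j k - G j.+1 k.
Proof.
move=> /andP[r0 r1] [cM cS].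
have r1' : `|r| < 1 by rewrite ger0_norm.
pose s j k : R^nat := fun l => c j (k + l)%N.
have sle j k l : `|s j k l| <= geometric (M * r ^+ k) r l.
  by rewrite /= (le_trans (cM _ _))// exprD mulrA.
have ns j k : cvgn [normed series (s j k)].
  apply: (@series_le_cvg _ _ (geometric (M * r ^+ k) r)) => //.
  - by move=> l /=.
  - by move=> l; exact: le_trans (normr_ge0 _) (sle j k l).
  - by move=> l; exact: sle.
  - exact: is_cvg_geometric_series.
have cs j k : cvgn (series (s j k)) by exact: normed_cvg.
have bs j k : `|limn (series (s j k))| <= M * r ^+ k * (1 - r)^-1.
  have -> : M * r ^+ k * (1 - r)^-1 = limn (series (geometric (M * r ^+ k) r)).
    by apply/esym/cvg_lim => //; exact: cvg_geometric_series.
  apply: (le_trans (lim_series_norm (ns j k))).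
  apply: lim_series_le; first exact: ns.
    exact: is_cvg_geometric_series.
  exact: sle.
pose G j k := limn (series (s j k)) / 2.
(* The recurrence reads [c j m - c j.+1 m = 2 * (c j m - c j m.+1)], so the sum telescopes. *)
have d j k l : series (s j k) l - series (s j.+1 k) l = 2 * (c j k - c j (k + l)%N).
  rewrite /series/=; elim: l => [|l IH].
    by rewrite !big_geq// addn0 !subrr mulr0.
  rewrite !big_nat_recr//= opprD addrACA IH /s addnS cS; lra.
have e j k l : series (s j k.+1) l = (series (s j k) l + series (s j.+1 k) l) / 2.
  rewrite /series/= -big_split/= big_distrl/=; apply: eq_bigr => i _.
  by rewrite /s addSn cS.
exists (M / (1 - r) / 2), G; split; first split.
- move=> j k; rewrite /G normrM (_ : `|2^-1| = 2^-1 :> R); last first.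
    by rewrite ger0_norm.
  have -> : M / (1 - r) / 2 * r ^+ k = M * r ^+ k * (1 - r)^-1 / 2 by ring.
  by rewrite ler_pM2r ?invr_gt0//.
- move=> j k; rewrite /G; congr (_ / _); apply: cvg_lim => //.
  rewrite (_ : series (s j k.+1) = fun l =>
    (series (s j k) l + series (s j.+1 k) l) / 2); last exact/funext/e.
  by rewrite -mulrDl; apply: cvgMl; apply: cvgD; exact: cs.
- move=> j k.
  have h1 : series (s j k) l - series (s j.+1 k) l @[l --> \oo] -->
      limn (series (s j k)) - limn (series (s j.+1 k)).
    by apply: cvgB; exact: cs.
  have h2 : series (s j k) l - series (s j.+1 k) l @[l --> \oo] -->
      2 * (c j k - 0).
    under eq_fun do rewrite d.
    apply: cvgMr; apply: cvgB; first exact: cvg_cst.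
    exact: cvg_series_cvg_0 (cs j k).
  rewrite /G -mulrBl (cvg_unique _ h1 h2)// subr0; lra.
Qed.

(** The potential of a geometrically averaging family is again one, so it can be taken twice; two
    successive differences in [j] make a second difference. *)
Lemma geometric_averaging_second_difference M r c : 0 <= r < 1 ->
  geometric_averaging M r c ->
  exists u B, (forall k, c k 0%N = u k - 2 * u k.+1 + u k.+2) /\
    (forall k, `|u k| <= B).
Proof.
move=> r01 /(geometric_averaging_potential r01)[M1 [G1 [avG1 cG1]]].
have [M2 [G2 [[bG2 _] G12]]] := geometric_averaging_potential r01 avG1.
exists (fun k => G2 k 0%N), M2; split => k.
  by rewrite cG1 !G12; ring.
by rewrite (le_trans (bG2 k 0%N))// expr0 mulr1.
Qed.

Lemma cvg_mean_sum_dist M r c : 0 <= r < 1 -> geometric_averaging M r c ->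
  cvgn (fun n => (\sum_(i < n.+1) \sum_(j < n.+1)
    c ((i - j) + (j - i))%N 0%N) / n.+1%:R).
Proof.
move=> r01 /(geometric_averaging_second_difference r01)[u [B [cu uB]]].
(* The limit is the slope in [sum_dist_second_difference]; the remainder is at most [4 * B / n.+1],
   since it involves twice a difference of two values of [u]. *)
pose L := c 0%N 0%N + 2 * (u 1%N - u 2%N).
have e n : (\sum_(i < n.+1) \sum_(j < n.+1)
    c ((i - j) + (j - i))%N 0%N) / n.+1%:R =
    L - 2 * (u 1%N - u n.+2) / n.+1%:R.
  have -> : \sum_(i < n.+1) \sum_(j < n.+1) c ((i - j) + (j - i))%N 0%N =
      \sum_(i < n.+1) \sum_(j < n.+1) (u ((i - j) + (j - i))%N -
        2 * u ((i - j) + (j - i)).+1 + u ((i - j) + (j - i)).+2).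
    by apply: eq_bigr => i _; apply: eq_bigr => j _.
  rewrite (sum_dist_second_difference u) -cu -/L mulrBl.
  by rewrite [n.+1%:R * L]mulrC mulfK ?pnatr_eq0.
under eq_fun do rewrite e.
apply/cvg_ex; exists (L - 0); apply: cvgB; first exact: cvg_cst.
apply: norm_cvg0.
apply: (@squeeze_cvgr _ _ _ _ (cst 0) (fun n => 4 * B * n.+1%:R^-1)).
- apply: nearW => n /=; rewrite normr_ge0/= normrM.
  rewrite [X in _ * X]ger0_norm ?invr_ge0// ler_wpM2r ?invr_ge0//.
  rewrite normrM ger0_norm// (le_trans (ler_wpM2l _ (ler_normB _ _)))//.
  by have := uB 1%N; have := uB n.+2; lra.
- exact: cvg_cst.
- rewrite -[X in _ --> X](mulr0 (4 * B)); apply: cvgMr; exact: cvg_harmonic.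
Qed.

End second_difference.

(** * The kernel as an operator on square-integrable functions *)

Section averaging_operator.
Context d (T : measurableType d) (R : realType) (pi : probability T R)
  (P : R.-pker T ~> T).
Hypothesis piP : stationary pi P.
Implicit Types f g h : T -> R.

Let Q f : T -> R := fine \o kernel_operator P (EFin \o f).

Let kernel_operatorE f : (forall x, 0 <= f x) ->
  forall x, (0 <= kernel_operator P (EFin \o f) x)%E.
Proof. by move=> f0 x; apply: kernel_operator_ge0 => y; rewrite lee_fin. Qed.

Let mQ f : (forall x, 0 <= f x) -> measurable_fun setT f ->
  measurable_fun setT (Q f).
Proof.
move=> f0 mf; apply: measurableT_comp => //.
by apply: measurable_kernel_operator => //; exact/measurable_EFinP.
Qed.

(** Jensen's inequality, obtained by integrating [2 s f(y) <= s^2 + f(y)^2] against [P x], where [s]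
    is the mean of [f] under [P x]. *)
Let Q_sqr f x : (forall x, 0 <= f x) -> measurable_fun setT f ->
  ((Q f x ^+ 2)%:E <= kernel_operator P (EFin \o (fun x => f x ^+ 2)%R) x)%E.
Proof.
move=> f0 mf; set K := kernel_operator _ _ _.
have K0 : (0 <= K)%E by apply: kernel_operatorE => y; exact: sqr_ge0.
rewrite /Q /=; have := kernel_operatorE f0 x.
(* [fine] reads an infinite mean as 0, and the bound is then trivial. *)
case E : (kernel_operator P (EFin \o f) x) => [s| |] //=; last first.
  by rewrite expr0n.
rewrite lee_fin => s0.
have : ((2 * s * s)%:E <= (s ^+ 2)%:E + K)%E.
  rewrite EFinM -E /kernel_operator -ge0_integralZl//=; last 3 first.
  - exact/measurable_EFinP.
  - by move=> y _; rewrite lee_fin.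
  - by rewrite lee_fin mulr_ge0.
  have -> : (s ^+ 2)%:E = (\int[P x]_y (s ^+ 2)%:E)%E.
    by rewrite integral_cst// prob_kernel mule1.
  rewrite -ge0_integralD//; last 3 first.
  - by move=> y _; rewrite lee_fin sqr_ge0.
  - by move=> y _; rewrite lee_fin sqr_ge0.
  - by apply/measurable_EFinP; exact: measurable_funX.
  apply: ge0_le_integral => //.
  - by move=> y _; rewrite lee_fin !mulr_ge0.
  - by apply: measurable_funeM; exact/measurable_EFinP.
  - apply: emeasurable_funD => //; apply/measurable_EFinP; exact: measurable_funX.
  - move=> y _; rewrite -EFinM -EFinD lee_fin -subr_ge0.
    by rewrite (_ : _ - _ = (s - f y) ^+ 2) ?sqr_ge0//; ring.
case: K K0 => [k| |] // _; last by move=> _; exact: leey.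
by rewrite -EFinD !lee_fin; lra.
Qed.

Let Q2 f : (forall x, 0 <= f x) -> f \in Lfun pi 2%:E -> Q f \in Lfun pi 2%:E.
Proof.
move=> f0 /Lfun2P[mf foo]; apply/Lfun2P; split; first exact: mQ.
rewrite -(integral_kernel_operator piP) in foo; last 2 first.
  by move=> x; rewrite lee_fin sqr_ge0.
  by apply/measurable_EFinP; exact: measurable_funX.
apply: le_lt_trans foo; apply: ge0_le_integral => //.
- by move=> x _; rewrite lee_fin sqr_ge0.
- by apply/measurable_EFinP; apply: measurable_funX; exact: mQ.
- apply: measurable_kernel_operator.
    by move=> x; rewrite lee_fin sqr_ge0.
  by apply/measurable_EFinP; exact: measurable_funX.
- by move=> x _; exact: Q_sqr.
Qed.

Let lag_cov_Q_ge0 k f g : (forall x, 0 <= f x) -> (forall x, 0 <= g x) ->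
  f \in Lfun pi 2%:E -> g \in Lfun pi 2%:E ->
  lag_cov pi P k f (Q g) = lag_cov pi P k.+1 f g.
Proof.
move=> f0 g0 f2 g2; have [mf mg] := (Lfun2_measurable f2, Lfun2_measurable g2).
pose K := kernel_operator P (EFin \o g).
have mK : measurable_fun setT K.
  by apply: measurable_kernel_operator => //; exact/measurable_EFinP.
have K0 : forall x, (0 <= K x)%E by exact: kernel_operatorE.
rewrite /lag_cov /Rintegral; congr fine.
rewrite (integral_chain_pair piP (f := EFin \o f) (g := EFin \o g))//=; last 2 first.
  exact/measurable_EFinP.
  exact/measurable_EFinP.
rewrite -iterS iterSr -/K.
have := @integral_chain_pair _ _ _ _ _ piP k ord0 ord_max (EFin \o f) K.
rewrite /= subn0 => <- //; last exact/measurable_EFinP.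
have mcoord i : measurable_fun setT (fun x : k.+1.-tuple T => tnth x i).
  exact: measurable_tnth.
have mKc : measurable_fun setT (fun x : k.+1.-tuple T => K (tnth x ord_max)).
  exact: measurableT_comp.
have mfc : measurable_fun setT (fun x : k.+1.-tuple T => f (tnth x ord0)).
  exact: measurableT_comp.
apply: ge0_ae_eq_integral => //.
- apply/measurable_EFinP; apply: measurable_funM => //.
  by apply: measurableT_comp => //; exact: mQ.
- by apply: emeasurable_funM => //; exact/measurable_EFinP.
- by move=> x _; rewrite lee_fin mulr_ge0//; exact: fine_ge0.
- by move=> x _; rewrite mule_ge0// lee_fin.
(* By stationarity [K] has the same finite integral as [g]; hence it is almost surely finite, and
   there [fine] changes nothing. *)
have iK : (chain_law pi P k).-integrable setT (fun x => K (tnth x ord_max)).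
  apply/integrableP; split => //.
  under eq_integral do rewrite gee0_abs//.
  rewrite (integral_chain_coord piP)// integral_kernel_operator//; last first.
    exact/measurable_EFinP.
  exact: integrable_lty (Lfun2_integrable g2).
have := integrable_ae measurableT iK.
by apply: filterS => x /(_ I) Kx _; rewrite EFinM fineK.
Qed.

(* [P] acting on signed functions; it differs from [x |-> \int[P x]_y f y] only
   on the [pi]-negligible set where a part of [f] is not [P x]-integrable. *)
Definition averaging f : T -> R := fun x => Q f^\+ x - Q f^\- x.

Lemma Lfun2_averaging f : f \in Lfun pi 2%:E -> averaging f \in Lfun pi 2%:E.
Proof.
move=> f2; apply: Lfun2B; apply: Q2 => //.
  exact: Lfun2_funrpos.
exact: Lfun2_funrneg.
Qed.

Lemma lag_cov_averaging k f g : f \in Lfun pi 2%:E -> g \in Lfun pi 2%:E ->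
  lag_cov pi P k f (averaging g) = lag_cov pi P k.+1 f g.
Proof.
move=> f2 g2.
have [fp fn] := (Lfun2_funrpos f2, Lfun2_funrneg f2).
have [gp gn] := (Lfun2_funrpos g2, Lfun2_funrneg g2).
have posnegE (u : T -> R) : u = (fun x => u^\+ x - u^\- x).
  by rewrite -[LHS]funrposBneg.
have Qg : averaging g \in Lfun pi 2%:E by exact: Lfun2_averaging.
rewrite [f]posnegE [X in _ = lag_cov _ _ _ _ X]posnegE.
rewrite !lag_covBl ?lag_covBr ?Lfun2B//; try exact: Q2.
by rewrite !lag_cov_Q_ge0.
Qed.

(* [<Pf, Pf> = E[Pf(X_0) f(X_1)]], to which Young's inequality applies. *)
Lemma averaging_contraction f : f \in Lfun pi 2%:E ->
  lag_cov pi P 0 (averaging f) (averaging f) <= lag_cov pi P 0 f f.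
Proof.
move=> f2; have Af2 := Lfun2_averaging f2.
have := lag_cov_young piP 1 1 1 Af2 f2.
rewrite -lag_cov_averaging// expr1n => h.
have := ler_norm (lag_cov pi P 0 (averaging f) (averaging f)); lra.
Qed.

Lemma Rintegral_averaging f : f \in Lfun pi 2%:E ->
  \int[pi]_x averaging f x = \int[pi]_x f x.
Proof.
move=> f2; have Af2 := Lfun2_averaging f2.
have c2 : cst 1 \in Lfun pi 2%:E by exact: Lfun_cst.
have := lag_cov_averaging 0 c2 f2; rewrite /lag_cov.
under eq_Rintegral do rewrite mul1r.
rewrite (Rintegral_coord piP _ (Lfun2_measurable Af2)) => ->.
under eq_Rintegral do rewrite mul1r.
exact: (Rintegral_coord piP _ (Lfun2_measurable f2)).
Qed.

End averaging_operator.

(** * Lazy iterates and the limit of the variances *)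

Section spectral_gap.
Context d (T : measurableType d) (R : realType) (pi : probability T R)
  (P : R.-pker T ~> T).
Hypothesis piP : stationary pi P.
Implicit Types f g h : T -> R.

Variable lam : R.
Hypothesis lam01 : 0 < lam <= 1.
Hypothesis gap : forall f, f \in Lfun pi 2%:E -> \int[pi]_x f x = 0 ->
  lag_cov pi P 1 f f <= (1 - lam) * lag_cov pi P 0 f f.

(** The hypothesis [gap] bounds [<f, P f>] from one side and does not make [P] a strict contraction;
    averaging with the identity does. *)
Let lazy f : T -> R := fun x => (f x + averaging P f x) / 2.

Let lazyE f : lazy f = fun x => 2^-1 * (f x + averaging P f x).
Proof. by apply/funext => x; rewrite /lazy mulrC. Qed.

Let Lfun2_lazy f : f \in Lfun pi 2%:E -> lazy f \in Lfun pi 2%:E.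
Proof.
move=> f2; rewrite lazyE; apply: Lfun2Z; apply: Lfun2D => //.
exact: Lfun2_averaging.
Qed.

Let Rintegral_lazy f : f \in Lfun pi 2%:E ->
  \int[pi]_x lazy f x = \int[pi]_x f x.
Proof.
move=> f2; have Af2 := Lfun2_averaging piP f2; rewrite lazyE RintegralZl//.
  rewrite RintegralD//; try exact: Lfun2_integrable.
  by rewrite Rintegral_averaging//; lra.
by apply: Lfun2_integrable; exact: Lfun2D.
Qed.

Let lag_cov_lazy k f g : f \in Lfun pi 2%:E -> g \in Lfun pi 2%:E ->
  lag_cov pi P k f (lazy g) =
  (lag_cov pi P k f g + lag_cov pi P k.+1 f g) / 2.
Proof.
move=> f2 g2; have Ag2 := Lfun2_averaging piP g2.
rewrite lazyE lag_covZr//; last exact: Lfun2D.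
by rewrite lag_covDr// lag_cov_averaging// mulrC.
Qed.

(** [4 |Lf|^2 = |f|^2 + 2 <f, Pf> + |Pf|^2 <= (4 - 2 lam) |f|^2], and
    [1 - lam / 2 <= (1 - lam / 4)^2]. *)
Let lazy_contraction f : f \in Lfun pi 2%:E -> \int[pi]_x f x = 0 ->
  lag_cov pi P 0 (lazy f) (lazy f) <= (1 - lam / 4) ^+ 2 * lag_cov pi P 0 f f.
Proof.
move=> f2 f0; have Af2 := Lfun2_averaging piP f2.
have h1 := gap f2 f0; have h2 := averaging_contraction piP f2.
have h3 := lag_cov0_ge0 pi P f.
have fAf2 : (fun x => f x + averaging P f x) \in Lfun pi 2%:E by exact: Lfun2D.
rewrite lazyE lag_covZl//; last exact: Lfun2Z.
rewrite lag_covZr// lag_covDl//.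
rewrite (lag_covDr piP 0 f2 f2 Af2) (lag_covDr piP 0 Af2 f2 Af2).
rewrite (lag_cov0C pi P (averaging P f) f) (lag_cov_averaging piP)//.
move: h1 h2 h3 lam01 => /=.
set a := lag_cov pi P 0 f f; set b := lag_cov pi P 1 f f.
set c := lag_cov pi P 0 _ _ => h1 h2 h3 /andP[lam0 lam1].
have -> : (1 - lam / 4) ^+ 2 * a = (1 - lam / 2) * a + (lam / 4) ^+ 2 * a by field.
have : 0 <= (lam / 4) ^+ 2 * a by rewrite mulr_ge0// sqr_ge0.
lra.
Qed.

Let F f k := iter k lazy f.

Let Lfun2_F f k : f \in Lfun pi 2%:E -> F f k \in Lfun pi 2%:E.
Proof. by move=> f2; elim: k => //= k IH; exact: Lfun2_lazy. Qed.

Let F_contraction f k : f \in Lfun pi 2%:E -> \int[pi]_x f x = 0 ->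
  lag_cov pi P 0 (F f k) (F f k) <=
  ((1 - lam / 4) ^+ k) ^+ 2 * lag_cov pi P 0 f f.
Proof.
move=> f2 f0.
have F0 j : \int[pi]_x F f j x = 0.
  elim: j => //= j IH; rewrite -[RHS]IH; apply: Rintegral_lazy; exact: Lfun2_F.
elim: k => [|k IH]; first by rewrite expr0 expr1n mul1r.
apply: (le_trans (lazy_contraction (Lfun2_F k f2) (F0 k))).
rewrite [_ ^+ k.+1]exprS exprMn -[leRHS]mulrA.
by rewrite ler_wpM2l ?sqr_ge0.
Qed.

Let F_geometric f : f \in Lfun pi 2%:E -> \int[pi]_x f x = 0 ->
  geometric_averaging (lag_cov pi P 0 f f) (1 - lam / 4)
    (fun j k => lag_cov pi P j f (F f k)).
Proof.
move=> f2 f0; split => [j k|j k]; last first.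
  exact: (lag_cov_lazy j f2 (Lfun2_F k f2)).
have r0 : 0 < (1 - lam / 4) ^+ k.
  by rewrite exprn_gt0//; case/andP: lam01 => _ ?; lra.
(* This weight balances [|f|^2] against the bound on [|L^k f|^2]; dividing by it then leaves one
   factor of the contraction rate to the power [k]. *)
have := lag_cov_young piP j ((1 - lam / 4) ^+ k) 1 f2 (Lfun2_F k f2).
have := F_contraction k f2 f0.
rewrite /= expr1n mul1r mulr1; move: r0; set r := (1 - _) ^+ k => r0 h1 h2.
rewrite -(ler_pM2l r0).
have -> : r * (lag_cov pi P 0 f f * r) = r ^+ 2 * lag_cov pi P 0 f f by ring.
lra.
Qed.

Lemma spectral_gap_variance_bounding : variance_bounding pi P.
Proof.
move=> h h2; set m := \int[pi]_y h y.
have c2 : cst m \in Lfun pi 2%:E by exact: Lfun_cst.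
pose f x := h x - m.
have f2 : f \in Lfun pi 2%:E by exact: Lfun2B.
have f0 : \int[pi]_x f x = 0.
  rewrite RintegralB//; try exact: Lfun2_integrable.
  rewrite Rintegral_cst//.
  have -> : fine (pi setT) = 1 by rewrite probability_setT.
  by rewrite mulr1 subrr.
have r01 : 0 <= 1 - lam / 4 < 1 by case/andP: lam01 => ? ?; apply/andP; split; lra.
have /cvg_ex[/= v cv] := cvg_mean_sum_dist r01 (F_geometric f2 f0).
exists v%:E; last exact: ltry.
rewrite /has_asymptotic_variance.
under eq_fun do rewrite variance_empirical_mean// chain_sum_sqE//.
by apply: cvg_EFin; [exact: nearW|exact: cv].
Qed.

End spectral_gap.

(** * Cheeger's inequality *)

Section cheeger.
Context d (T : measurableType d) (R : realType) (pi : probability T R)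
  (P : R.-pker T ~> T).
Hypothesis piP : stationary pi P.
Implicit Types (f g h : T -> R) (S : set T).

Lemma Lfun2_indic S : measurable S -> \1_S \in Lfun pi 2%:E.
Proof.
move=> mS; apply: (Lfun2_le (g := cst 1)).
- exact: measurable_indic.
- exact: Lfun_cst.
- by move=> x; rewrite indicE; case: (_ \in _); rewrite ?expr0n ?expr1n.
Qed.

Lemma lag_cov0E f g : f \in Lfun pi 2%:E -> g \in Lfun pi 2%:E ->
  lag_cov pi P 0 f g = \int[pi]_x (f x * g x).
Proof.
move=> f2 g2.
rewrite -(Rintegral_coord piP (n := 0) ord0 (f := fun x => f x * g x)); last first.
  by apply: measurable_funM; [exact: Lfun2_measurable f2|exact: Lfun2_measurable g2].
by apply: eq_Rintegral => x _; rewrite !ord1.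
Qed.

Lemma Rintegral_indic S : measurable S -> \int[pi]_x \1_S x = fine (pi S).
Proof. by move=> mS; rewrite /Rintegral integral_indic// setIT. Qed.

Lemma lag_cov_cst1r k f : f \in Lfun pi 2%:E ->
  lag_cov pi P k f (cst 1) = \int[pi]_x f x.
Proof.
move=> f2; rewrite /lag_cov; under eq_Rintegral do rewrite mulr1.
exact: (Rintegral_coord piP _ (Lfun2_measurable f2)).
Qed.

Lemma lag_cov_cst1l k f : f \in Lfun pi 2%:E ->
  lag_cov pi P k (cst 1) f = \int[pi]_x f x.
Proof.
move=> f2; rewrite /lag_cov; under eq_Rintegral do rewrite mul1r.
exact: (Rintegral_coord piP _ (Lfun2_measurable f2)).
Qed.

Lemma indicC_fun S : \1_(~` S) = (fun x => cst 1 x - \1_S x) :> (T -> R).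
Proof.
apply/funext => x; rewrite !indicE in_setC /=.
by case: (x \in S); rewrite ?subrr ?subr0.
Qed.

Lemma lag_cov_indicC k S : measurable S ->
  lag_cov pi P k \1_S \1_(~` S) = fine (pi S) - lag_cov pi P k \1_S \1_S.
Proof.
move=> mS; have S2 := Lfun2_indic mS.
have c2 : cst 1 \in Lfun pi 2%:E by exact: Lfun_cst.
by rewrite indicC_fun lag_covBr// lag_cov_cst1r// Rintegral_indic.
Qed.

(** Stationarity alone balances the flows into and out of [S]: each is [pi S] minus the probability
    of being in [S] at both times. *)
Lemma lag_cov_indicCl k S : measurable S ->
  lag_cov pi P k \1_(~` S) \1_S = lag_cov pi P k \1_S \1_(~` S).
Proof.
move=> mS; have S2 := Lfun2_indic mS.
have c2 : cst 1 \in Lfun pi 2%:E by exact: Lfun_cst.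
rewrite lag_cov_indicC// indicC_fun lag_covBl//.
by rewrite lag_cov_cst1l// Rintegral_indic.
Qed.

Lemma measure_bigcup_le (F : (set T)^nat) c : (forall n, measurable (F n)) ->
  nondecreasing_seq F -> (forall n, (pi (F n) <= c)%E) ->
  (pi (\bigcup_n F n) <= c)%E.
Proof.
move=> mF ndF Fc.
have cF := nondecreasing_cvg_mu (mu := pi) mF (bigcupT_measurable _ mF) ndF.
rewrite -(cvg_lim _ cF)//; apply: lime_le; last exact: nearW.
by apply/cvg_ex; eexists; exact: cF.
Qed.

Lemma measurable_sublevel f t : measurable_fun setT f ->
  measurable [set x | f x <= t].
Proof.
move=> mf; rewrite (_ : [set x | _] = setT `&` f @^-1` `]-oo, t]).
  exact: mf.
by rewrite setTI; apply/seteqP; split=> x; rewrite /= in_itv.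
Qed.

Lemma measurable_superlevel f t : measurable_fun setT f ->
  measurable [set x | t < f x].
Proof.
move=> mf; rewrite (_ : [set x | _] = setT `&` f @^-1` `]t, +oo[).
  exact: mf.
by rewrite setTI; apply/seteqP; split=> x; rewrite /= in_itv/= andbT.
Qed.

Lemma measure_superlevel f t : measurable_fun setT f ->
  (pi [set x | (t < f x)%R] = 1 - pi [set x | (f x <= t)%R])%E.
Proof.
move=> mf; rewrite -(probability_setC _ (measurable_sublevel t mf)).
by congr (pi _); apply/seteqP; split=> x /=; rewrite ltNge => /negP.
Qed.

(** [m] is the infimum of the levels whose sublevel set has measure above 1/2. Both bounds follow by
    continuity from below, along the levels [m + 1/(n+1)] and [m - 1/(n+1)]. The infimum is proper
    because sets of measure at most 1/2 cannot increase to the whole space ([halfT]). *)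
Lemma median f : measurable_fun setT f -> exists m,
  (pi [set x | (m < f x)%R] <= 2^-1%:E)%E /\
  (pi [set x | (f x < m)%R] <= 2^-1%:E)%E.
Proof.
move=> mf.
have half S : measurable S -> (2^-1%:E < pi S)%E -> (1 - pi S <= 2^-1%:E)%E.
  move=> mS; rewrite -(fineK (fin_num_measure pi _ mS)) lte_fin -EFinB lee_fin.
  lra.
have halfT (F : (set T)^nat) : (forall n, measurable (F n)) ->
    nondecreasing_seq F -> \bigcup_n F n = setT ->
    ~ (forall n, (pi (F n) <= 2^-1%:E)%E).
  move=> mF ndF FT Fc; have := measure_bigcup_le mF ndF Fc.
  by rewrite FT probability_setT lee_fin; lra.
pose A := [set t | (2^-1%:E < pi [set x | (f x <= t)%R])%E].
have A0 : A !=set0.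
  apply/set0P/negP => /eqP A0.
  apply: (halfT (fun n => [set x | f x <= n%:R])).
  - by move=> n; exact: measurable_sublevel.
  - move=> a b ab; apply/subsetPset => x /= /le_trans; apply.
    by rewrite ler_nat.
  - apply/seteqP; split=> // x _; exists (Num.bound `|f x|) => //=.
    exact/ltW/(le_lt_trans (ler_norm _))/archi_boundP/normr_ge0.
  - move=> n; rewrite leNgt; apply/negP => An.
    by have : A n%:R by []; rewrite A0.
have lA : has_lbound A.
  apply: contrapT => lA.
  apply: (halfT (fun n => [set x | - n%:R < f x])).
  - by move=> n; exact: measurable_superlevel.
  - move=> a b ab; apply/subsetPset => x /=; apply: le_lt_trans.
    by rewrite lerN2 ler_nat.
  - apply/seteqP; split=> // x _; exists (Num.bound `|f x|) => //=.
    rewrite ltrNl (le_lt_trans (ler_norm _))// normrN; exact/archi_boundP/normr_ge0.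
  - move=> n; rewrite measure_superlevel//; apply: half.
      exact: measurable_sublevel.
    rewrite ltNge; apply/negP => An; apply: lA; exists (- n%:R) => t At.
    rewrite leNgt; apply/negP => tn.
    have := lt_le_trans At (le_trans _ An).
    rewrite ltxx => /(_ _)/negP; apply => //; apply: le_measure.
    + by rewrite inE; exact: measurable_sublevel.
    + by rewrite inE; exact: measurable_sublevel.
    + by move=> x /= /le_trans; apply; exact: ltW.
have infA : has_inf A by [].
have small (e : R) : 0 < e -> exists n, n.+1%:R^-1 < e.
  by move=> /ltr_add_invr[n]; rewrite add0r; exists n.
exists (inf A); split.
- rewrite (_ : [set x | _] = \bigcup_n [set x | inf A + n.+1%:R^-1 < f x]).
    apply: measure_bigcup_le => [n|a b ab|n].
    + exact: measurable_superlevel.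
    + apply/subsetPset => x /=; apply: le_lt_trans.
      by rewrite lerD2l lef_pV2 ?posrE// ler_nat.
    + rewrite measure_superlevel//; apply: half.
        exact: measurable_sublevel.
      have n0 : 0 < n.+1%:R^-1 :> R by rewrite invr_gt0.
      have [t At tn] := inf_adherent n0 infA.
      apply: (lt_le_trans At); apply: le_measure.
      * by rewrite inE; exact: measurable_sublevel.
      * by rewrite inE; exact: measurable_sublevel.
      * by move=> x /= /le_trans; apply; exact: ltW.
  apply/seteqP; split=> [x /= fx|x [n _] /=]; last first.
    by apply: lt_trans; rewrite ltrDl.
  have [|n nx] := small (f x - inf A); first by rewrite subr_gt0.
  by exists n => //=; rewrite -ltrBrDl.
- rewrite (_ : [set x | _] = \bigcup_n [set x | f x <= inf A - n.+1%:R^-1]).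
    apply: measure_bigcup_le => [n|a b ab|n].
    + exact: measurable_sublevel.
    + apply/subsetPset => x /= /le_trans; apply.
      by rewrite lerD2l lerN2 lef_pV2 ?posrE// ler_nat.
    + rewrite leNgt; apply/negP => An.
      have := ge_inf lA An.
      by rewrite lerBrDr gerDl leNgt invr_gt0 ltr0n.
  apply/seteqP; split=> [x /= fx|x [n _] /=]; last first.
    by move=> /le_lt_trans; apply; rewrite ltrBlDr ltrDl.
  have [|n nx] := small (inf A - f x); first by rewrite subr_gt0.
  by exists n => //=; rewrite lerBrDl -lerBrDr ltW.
Qed.

End cheeger.

(** By the layer-cake formula both sides are integrals over [r >= 0] of tail probabilities. *)
Lemma superlevel_le_integral d1 d2 (T1 : measurableType d1)
    (T2 : measurableType d2) (R : realType) (P1 : probability T1 R)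
    (P2 : probability T2 R) (f : T1 -> R) (g : T2 -> R) (c : R) : 0 <= c ->
  measurable_fun setT f -> measurable_fun setT g ->
  (forall x, 0 <= f x) -> (forall x, 0 <= g x) ->
  (forall r, 0 <= r -> c * fine (P1 [set x | r < f x]) <=
    fine (P2 [set x | r < g x])) ->
  (c%:E * \int[P1]_x (f x)%:E <= \int[P2]_x (g x)%:E)%E.
Proof.
move=> c0 mf mg f0 g0 fg.
pose X : {RV P1 >-> R} := mfun_Sub (mem_set mf).
pose Y : {RV P2 >-> R} := mfun_Sub (mem_set mg).
have := @ge0_expectation_ccdf _ _ _ _ X f0; rewrite unlock => ->.
have := @ge0_expectation_ccdf _ _ _ _ Y g0; rewrite unlock => ->.
have mc : measurable_fun (`[0%R, +oo[%classic : set R) (ccdf X).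
  by apply: measurable_funTS; exact: ccdf_measurable.
rewrite -ge0_integralZl//.
apply: ge0_le_integral => //.
- by move=> r _; rewrite mule_ge0.
- exact: measurable_funeM.
- by apply: measurable_funTS; exact: ccdf_measurable.
move=> r; rewrite [X in X -> _]/= in_itv [X in X -> _]/= andbT => r0.
have -> : ccdf X r = P1 [set x | r < f x].
  rewrite /ccdf /distribution /pushforward; congr (P1 _).
  by apply/seteqP; split=> x; rewrite /= in_itv/= andbT.
have -> : ccdf Y r = P2 [set x | r < g x].
  rewrite /ccdf /distribution /pushforward; congr (P2 _).
  by apply/seteqP; split=> x; rewrite /= in_itv/= andbT.
have mXr : measurable [set x | r < f x] by exact: measurable_superlevel.
have mYr : measurable [set x | r < g x] by exact: measurable_superlevel.
rewrite -(fineK (fin_num_measure P1 _ mXr)) -(fineK (fin_num_measure P2 _ mYr)).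
by rewrite -EFinM lee_fin fg.
Qed.

(** * Conductance and the Dirichlet form *)

Section cheeger_inequality.
Context d (T : measurableType d) (R : realType) (pi : probability T R)
  (P : R.-pker T ~> T).
Hypothesis piP : stationary pi P.
Implicit Types (f g h : T -> R) (S : set T).

(** A lower bound on the conductance, stated without a quotient so that null sets need no
    exclusion. *)
Definition conductance_ge (kappa : R) := forall S, measurable S ->
  (pi S <= 2^-1%:E)%E ->
  kappa * fine (pi S) <= lag_cov pi P 1 \1_S \1_(~` S).

Definition dirichlet f := lag_cov pi P 0 f f - lag_cov pi P 1 f f.

Let integrable_sqr_coord f a b : f \in Lfun pi 2%:E ->
  (chain_law pi P 1).-integrable setT (EFin \o
    (fun x => (a * f (tnth x ord0) + b * f (tnth x ord_max)) ^+ 2)).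
Proof.
move=> f2; apply: Lfun2_integrable_sqr; apply: Lfun2D.
  by apply: Lfun2Z; exact: Lfun2_coord.
by apply: Lfun2Z; exact: Lfun2_coord.
Qed.

Let integrable_increment f : f \in Lfun pi 2%:E ->
  (chain_law pi P 1).-integrable setT (EFin \o
    (fun x => (f (tnth x ord0) - f (tnth x ord_max)) ^+ 2)).
Proof.
by move=> f2; apply: Lfun2_integrable_sqr; apply: Lfun2B; exact: Lfun2_coord.
Qed.

(** [f(X_0)] and [f(X_1)] have the same second moment, so expanding the square requires no
    reversibility. *)
Lemma dirichletE f : f \in Lfun pi 2%:E -> 2 * dirichlet f =
  \int[chain_law pi P 1]_x (f (tnth x ord0) - f (tnth x ord_max)) ^+ 2.
Proof.
move=> f2; have := lag_cov_sqrD piP 1 1 (-1) f2 f2.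
under eq_Rintegral do rewrite mul1r mulN1r.
by move=> ->; rewrite /dirichlet; ring.
Qed.

Lemma dirichlet_ge0 f : f \in Lfun pi 2%:E -> 0 <= dirichlet f.
Proof.
move=> f2; rewrite -(pmulr_rge0 _ (ltr0n R 2)) dirichletE//.
by apply: Rintegral_ge0 => x _; exact: sqr_ge0.
Qed.

Variable kappa : R.
Hypotheses (kappa0 : 0 < kappa) (kappaP : conductance_ge kappa).

(* The superlevel sets of [max (g x0) (g x1)] are the events that the chain
   visits a superlevel set of [g] at time 0 or 1. *)
Lemma max_coord_superlevel g s : measurable_fun setT g ->
  (pi [set x | (s < g x)%R] <= 2^-1%:E)%E ->
  (1 + kappa) * fine (pi [set x | s < g x]) <=
  fine (chain_law pi P 1
    [set x | s < Num.max (g (tnth x ord0)) (g (tnth x ord_max))]).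
Proof.
move=> mg; set S := [set x | s < g x] => S12.
have mS : measurable S by exact: measurable_superlevel.
have mc (i : 'I_2) A : measurable A ->
    measurable [set x : 2.-tuple T | A (tnth x i)].
  by move=> mA; rewrite -[X in measurable X]setTI; exact: measurable_tnth.
(* A visit at time 0 has probability [pi S]; a first visit at time 1 is a flow into [S], which is at
   least [kappa * pi S]. *)
have -> : [set x : 2.-tuple T |
      s < Num.max (g (tnth x ord0)) (g (tnth x ord_max))] =
    [set x | S (tnth x ord0)] `|`
    ([set x | (~` S) (tnth x ord0)] `&` [set x | S (tnth x ord_max)]).
  apply/seteqP; split => x; rewrite /S /= lt_max.
    case: (boolP (s < g (tnth x ord0))) => /= h; first by left.
    by move=> h'; right; split => //; exact/negP.
  by case=> [->//|[_ ->]]; rewrite orbT.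
have mSC := measurableC mS.
rewrite measureU; [|exact: mc|by apply: measurableI; exact: mc|]; last first.
  by apply/seteqP; split=> // x [/= ? []].
rewrite fineD ?fin_num_measure//; [|exact: mc|by apply: measurableI; exact: mc].
rewrite mulrDl mul1r lerD//.
  rewrite le_eqVlt; apply/orP; left; apply/eqP; congr fine.
  transitivity (\int[pi]_x (\1_S x)%:E)%E; first by rewrite integral_indic ?setIT.
  transitivity (\int[chain_law pi P 1]_x
      (\1_[set x : 2.-tuple T | S (tnth x ord0)] x)%:E)%E; last first.
    by rewrite integral_indic ?setIT//; exact: mc.
  rewrite -(integral_chain_coord piP (n := 1) ord0 (f := EFin \o \1_S))//.
    by move=> x; rewrite lee_fin.
  by apply/measurable_EFinP; exact: measurable_indic.
apply: (le_trans (kappaP mS S12)); rewrite -lag_cov_indicCl//.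
rewrite /lag_cov /Rintegral.
rewrite (eq_integral (EFin \o \1_([set x : 2.-tuple T | (~` S) (tnth x ord0)]
  `&` [set x : 2.-tuple T | S (tnth x ord_max)]))).
  by rewrite integral_indic ?setIT//; apply: measurableI; exact: mc.
move=> x _; rewrite /= indicI /=; congr (_ * _)%:E; by rewrite !indicE !inE.
Qed.

(* AM-GM, applied to [u ^+ 2 - v ^+ 2 = (u - v) * (u + v)]. *)
Let sqr_max_le (u v t : R) : 0 < t ->
  Num.max (u ^+ 2) (v ^+ 2) <=
  4^-1 * ((1 + t) * (u - v) ^+ 2 + (1 + t^-1) * (u + v) ^+ 2).
Proof.
move=> t0.
have h (a b : R) : a ^+ 2 <=
    4^-1 * ((1 + t) * (a - b) ^+ 2 + (1 + t^-1) * (a + b) ^+ 2).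
  rewrite -subr_ge0 (_ : _ - _ = (4 * t)^-1 * (t * (a - b) - (a + b)) ^+ 2).
    by rewrite mulr_ge0 ?sqr_ge0// invr_ge0 mulr_ge0// ltW.
  by field; rewrite gt_eqF.
rewrite ge_max h/=.
by rewrite (_ : (u - v) ^+ 2 = (v - u) ^+ 2) ?(addrC u v)//; ring.
Qed.

(** The layer-cake comparison gives [(1 + kappa) |f|^2 <= E[max(f(X_0)^2, f(X_1)^2)]]. The maximum
    is controlled by the squared difference and the squared sum, whose means are twice the Dirichlet
    form and [4 |f|^2] minus that. *)
Lemma cheeger_nonneg f : f \in Lfun pi 2%:E -> (forall x, 0 <= f x) ->
  (pi [set x | (0 < f x)%R] <= 2^-1%:E)%E ->
  kappa ^+ 2 / 2 * lag_cov pi P 0 f f <= dirichlet f.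
Proof.
move=> f2 f0 f12; have mf := Lfun2_measurable f2.
pose g x := f x ^+ 2.
have mg : measurable_fun setT g by exact: measurable_funX.
pose G (x : 2.-tuple T) := Num.max (g (tnth x ord0)) (g (tnth x ord_max)).
have mcoord (i : 'I_2) : measurable_fun setT (fun x : 2.-tuple T => tnth x i).
  exact: measurable_tnth.
have mG : measurable_fun setT G.
  by apply: measurable_maxr; exact: measurableT_comp.
have g0 x : 0 <= g x by exact: sqr_ge0.
have G0 x : 0 <= G x by rewrite le_max g0.
have key : ((1 + kappa)%:E * \int[pi]_x (g x)%:E <=
    \int[chain_law pi P 1]_x (G x)%:E)%E.
  apply: superlevel_le_integral => //; first by rewrite addr_ge0// ltW.
  move=> r r0; apply: max_coord_superlevel => //.
  apply: le_trans f12; apply: le_measure; rewrite ?inE.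
  - exact: measurable_superlevel.
  - exact: measurable_superlevel.
  - move=> x /= /(le_lt_trans r0); rewrite /g lt0r sqrf_eq0 => /andP[fx _].
    by rewrite lt0r fx f0.
have ig : pi.-integrable setT (EFin \o g) by exact: Lfun2_integrable_sqr.
have iD := integrable_sqr_coord 1 (-1) f2.
have iA := integrable_sqr_coord 1 1 f2.
have sD := lag_cov_sqrD piP 1 1 (-1) f2 f2.
have sA := lag_cov_sqrD piP 1 1 1 f2 f2.
(* With [1 / t = kappa / 2] the squared sum uses up half of the gain [kappa]; the other half is
   bounded by [t / 2] times the Dirichlet form. *)
set t := 2 / kappa; have t0 : 0 < t by rewrite divr_gt0.
pose H (x : 2.-tuple T) :=
  4^-1 * (1 + t) * (1 * f (tnth x ord0) + -1 * f (tnth x ord_max)) ^+ 2 +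
  4^-1 * (1 + t^-1) * (1 * f (tnth x ord0) + 1 * f (tnth x ord_max)) ^+ 2.
have GH x : G x <= H x.
  apply: (le_trans (sqr_max_le _ _ t0)).
  by rewrite /H !mul1r mulN1r mulrDr !mulrA.
have iH : (chain_law pi P 1).-integrable setT (EFin \o H).
  by apply: integrable_EFinD; exact: integrable_EFinZl.
have : (((1 + kappa) * lag_cov pi P 0 f f)%:E <=
    (\int[chain_law pi P 1]_x H x)%:E)%E.
  rewrite lag_cov0E// EFinM /Rintegral !fineK//; last 2 first.
  - exact: integrable_fin_num ig.
  - exact: integrable_fin_num iH.
  apply: (le_trans key); apply: ge0_le_integral => //.
  - by move=> x _; rewrite lee_fin.
  - exact/measurable_EFinP.
  - exact: measurable_int iH.
  - by move=> x _; rewrite lee_fin.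
rewrite lee_fin RintegralD//; try exact: integrable_EFinZl.
rewrite !RintegralZl// sD sA.
have E0 := dirichlet_ge0 f2; rewrite /dirichlet in E0 *.
move: E0; set a := lag_cov _ _ 0 _ _; set b := lag_cov _ _ 1 _ _ => E0 h.
suff : kappa * a / 2 <= (a - b) / kappa.
  rewrite ler_pdivlMr//; apply: le_trans.
  by rewrite (_ : kappa ^+ 2 / 2 * a = kappa * a / 2 * kappa)//; ring.
have -> : (a - b) / kappa = t / 2 * (a - b) by rewrite /t; field; rewrite gt_eqF.
have tk : t^-1 = kappa / 2 by rewrite /t; field; rewrite gt_eqF.
rewrite {}tk in h.
have := mulr_ge0 (ltW kappa0) E0.
lra.
Qed.

(** Subtracting a median keeps the Dirichlet form and can only increase the second moment of a
    centred function. The positive and negative parts of the result are then supported on sets of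
    measure at most 1/2, as [cheeger_nonneg] requires. *)
Lemma cheeger f : f \in Lfun pi 2%:E -> \int[pi]_x f x = 0 ->
  kappa ^+ 2 / 2 * lag_cov pi P 0 f f <= dirichlet f.
Proof.
move=> f2 f0; have [m [m1 m2]] := median pi (Lfun2_measurable f2).
have c2 r : cst r \in Lfun pi 2%:E by exact: Lfun_cst.
pose g x := f x - m.
have g2 : g \in Lfun pi 2%:E by exact: (Lfun2B f2 (c2 m)).
have [p2 n2] := (Lfun2_funrpos g2, Lfun2_funrneg g2).
have pn x : [/\ 0 <= g^\+ x, 0 <= g^\- x, g^\+ x * g^\- x = 0 &
    g x = g^\+ x - g^\- x].
  split => //; last by rewrite -[in LHS](funrposBneg g).
  rewrite /funrpos /funrneg /=; case: (leP 0 (g x)) => gx.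
    by have /max_idPr -> : - g x <= 0; rewrite ?oppr_le0 ?mulr0.
  by rewrite mul0r.
have fg : lag_cov pi P 0 f f <= lag_cov pi P 0 g g.
  have := lag_cov_sqrD piP 0 1 (- m) f2 (c2 1).
  rewrite lag_cov_cst1r// f0 mulr0 addr0 expr1n mul1r => h.
  have -> : lag_cov pi P 0 g g = lag_cov pi P 0 f f +
      (- m) ^+ 2 * lag_cov pi P 0 (cst 1) (cst 1).
    by rewrite -h; apply: eq_Rintegral => x _; rewrite !ord1 /g /=; ring.
  by rewrite lerDl mulr_ge0 ?sqr_ge0// lag_cov0_ge0.
have Ef : dirichlet f = dirichlet g.
  apply: (@mulfI _ 2); first by rewrite pnatr_eq0.
  rewrite !dirichletE//; apply: eq_Rintegral => x _.
  by rewrite /g; congr (_ ^+ 2); ring.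
have gpn : lag_cov pi P 0 g g =
    lag_cov pi P 0 g^\+ g^\+ + lag_cov pi P 0 g^\- g^\-.
  rewrite !lag_cov0E// -RintegralD//; try exact: Lfun2_integrableM.
  apply: eq_Rintegral => x _; have [_ _ pn0 gE] := pn x.
  rewrite gE.
  have -> : (g^\+ x - g^\- x) * (g^\+ x - g^\- x) = g^\+ x * g^\+ x +
    g^\- x * g^\- x - 2 * (g^\+ x * g^\- x) by ring.
  by rewrite pn0 mulr0 subr0.
(* The squared increment of [g] exceeds those of its two parts by cross terms between the two times,
   which are nonnegative. *)
have Eg : dirichlet g^\+ + dirichlet g^\- <= dirichlet g.
  rewrite -(ler_pM2l (ltr0n R 2)) mulrDr !dirichletE// -RintegralD//.
  - apply: le_Rintegral => //.
    + by apply: integrable_EFinD; exact: integrable_increment.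
    + exact: integrable_increment.
    move=> x _; set y := tnth x ord0; set z := tnth x ord_max.
    have [py ny pny gy] := pn y; have [pz nz pnz gz] := pn z.
    rewrite gy gz -subr_ge0.
    rewrite (_ : _ - _ = 2 * (g^\+ y * g^\- z + g^\+ z * g^\- y) -
      2 * (g^\+ y * g^\- y) - 2 * (g^\+ z * g^\- z)); last by ring.
    by rewrite pny pnz mulr0 !subr0 mulr_ge0// addr_ge0// mulr_ge0.
  - exact: integrable_increment.
  - exact: integrable_increment.
rewrite Ef; apply: le_trans Eg.
apply: (@le_trans _ _ (kappa ^+ 2 / 2 * lag_cov pi P 0 g g)).
  by rewrite ler_wpM2l// divr_ge0// sqr_ge0.
rewrite gpn mulrDr; apply: lerD.
  apply: cheeger_nonneg => //; apply: le_trans m1.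
  rewrite le_eqVlt; apply/orP; left; apply/eqP; congr (pi _).
  by apply/seteqP; split=> x; rewrite /funrpos /= lt_max ltxx orbF subr_gt0.
apply: cheeger_nonneg => //; apply: le_trans m2.
rewrite le_eqVlt; apply/orP; left; apply/eqP; congr (pi _).
by apply/seteqP; split=> x; rewrite /funrneg /= lt_max ltxx orbF oppr_gt0 subr_lt0.
Qed.

Lemma conductance_variance_bounding : variance_bounding pi P.
Proof.
(* Cheeger's constant is capped at 1 to meet the hypothesis [lam <= 1]. *)
apply: (@spectral_gap_variance_bounding _ _ _ _ _ piP
  (Num.min 1 (kappa ^+ 2 / 2))).
  by rewrite lt_min ltr01 ge_min lexx /= divr_gt0// exprn_gt0.
move=> f f2 f0; have h := cheeger f2 f0.
rewrite mulrBl mul1r lerBrDr -lerBrDl.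
apply: le_trans h; apply: ler_wpM2r; first exact: lag_cov0_ge0.
by rewrite ge_min lexx orbT.
Qed.

End cheeger_inequality.

(** * Variance bounding kernels have positive conductance *)

Section low_conductance.
Context d (T : measurableType d) (R : realType) (pi : probability T R)
  (P : R.-pker T ~> T).
Hypothesis piP : stationary pi P.
Implicit Types (f g h : T -> R) (S : set T).

(** A chain that starts in [S] and is outside at time [k + 1] is already outside at time [k] or
    leaves during the last step; by stationarity each step has the same exit flow. *)
Lemma lag_cov_indic_le k S : measurable S ->
  lag_cov pi P k \1_S \1_(~` S) <= k%:R * lag_cov pi P 1 \1_S \1_(~` S).
Proof.
move=> mS; have S2 := Lfun2_indic pi mS.
have SC2 := Lfun2_indic pi (measurableC mS).
elim: k => [|k IH].
  rewrite mul0r lag_cov0E//.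
  rewrite (@eq_Rintegral _ _ _ pi setT (cst 0)); first by rewrite Rintegral_cst// mul0r.
  move=> x _; rewrite !indicE in_setC /=.
  by case: (x \in S); rewrite ?mulr0 ?mul0r.
rewrite -natr1 mulrDl mul1r; apply: le_trans (lerD IH (lexx _)).
have ik : (inord k : 'I_k.+2) = k :> nat by rewrite inordK.
have -> : lag_cov pi P k \1_S \1_(~` S) = \int[chain_law pi P k.+1]_x
    (\1_S (tnth x ord0) * \1_(~` S) (tnth x (inord k))).
  by rewrite Rintegral_pair// ik subn0.
have -> : lag_cov pi P 1 \1_S \1_(~` S) = \int[chain_law pi P k.+1]_x
    (\1_S (tnth x (inord k)) * \1_(~` S) (tnth x ord_max)).
  by rewrite Rintegral_pair// ik//= subSnn.
rewrite -RintegralD//; try exact: integrable_coordM.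
apply: le_Rintegral => //.
- exact: integrable_coordM.
- by apply: integrable_EFinD; exact: integrable_coordM.
- move=> x _; rewrite !indicE !in_setC.
  by case: (tnth x ord0 \in S); case: (tnth x ord_max \in S);
    case: (tnth x (inord k) \in S); rewrite /= ?mulr0 ?mul0r ?mulr1 ?addr0 ?add0r.
Qed.

Definition center f : T -> R := fun x => f x - \int[pi]_y f y.

Lemma Lfun2_center f : f \in Lfun pi 2%:E -> center f \in Lfun pi 2%:E.
Proof. by move=> f2; apply: Lfun2B => //; exact: Lfun_cst. Qed.

Lemma lag_cov_cstr k f r : f \in Lfun pi 2%:E ->
  lag_cov pi P k f (cst r) = r * \int[pi]_x f x.
Proof.
move=> f2; have c2 : cst 1 \in Lfun pi 2%:E by exact: Lfun_cst.
rewrite -(lag_cov_cst1r piP k f2) -(lag_covZr piP)//; congr lag_cov.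
by apply/funext => x; rewrite /= mulr1.
Qed.

Lemma lag_cov_cstl k f r : f \in Lfun pi 2%:E ->
  lag_cov pi P k (cst r) f = r * \int[pi]_x f x.
Proof.
move=> f2; have c2 : cst 1 \in Lfun pi 2%:E by exact: Lfun_cst.
rewrite -(lag_cov_cst1l piP k f2) -(lag_covZl piP)//.
by congr lag_cov; apply/funext => x; rewrite /= mulr1.
Qed.

Lemma lag_cov_center k f : f \in Lfun pi 2%:E ->
  lag_cov pi P k (center f) (center f) =
  lag_cov pi P k f f - (\int[pi]_x f x) ^+ 2.
Proof.
move=> f2; have c2 r : cst r \in Lfun pi 2%:E by exact: Lfun_cst.
rewrite /center; set m := \int[pi]_y f y.
rewrite (lag_covBl piP k f2 (c2 m)); last exact: (Lfun2B f2 (c2 m)).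
rewrite !(lag_covBr piP k _ f2 (c2 m))// !lag_cov_cstr// lag_cov_cstl//.
by rewrite Rintegral_cst// (_ : fine (pi setT) = 1) ?probability_setT//= -/m; ring.
Qed.

Definition chain_var n f := chain_sum_sq pi P n (center f).

Lemma chain_var_ge0 n f : 0 <= chain_var n f.
Proof. exact: chain_sum_sq_ge0. Qed.

Lemma chain_var_le n f : f \in Lfun pi 2%:E ->
  chain_var n f <= n.+1%:R ^+ 2 * \int[pi]_x (f x ^+ 2).
Proof.
move=> f2; have fc2 := Lfun2_center f2.
apply: (le_trans (chain_sum_sq_le piP n fc2)).
rewrite ler_wpM2l ?sqr_ge0// lag_cov_center// lag_cov0E//.
by under eq_Rintegral do rewrite -expr2; rewrite lerBlDr lerDl sqr_ge0.
Qed.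

Lemma centerD f g : f \in Lfun pi 2%:E -> g \in Lfun pi 2%:E ->
  center (fun x => f x + g x) = (fun x => center f x + center g x).
Proof.
move=> f2 g2; apply/funext => x; rewrite /center RintegralD//; last 2 first.
- exact: Lfun2_integrable.
- exact: Lfun2_integrable.
ring.
Qed.

Lemma centerB f g : f \in Lfun pi 2%:E -> g \in Lfun pi 2%:E ->
  center (fun x => f x - g x) = (fun x => center f x - center g x).
Proof.
move=> f2 g2; apply/funext => x; rewrite /center RintegralB//; last 2 first.
- exact: Lfun2_integrable.
- exact: Lfun2_integrable.
ring.
Qed.

Lemma chain_var_parallelogram n f g : f \in Lfun pi 2%:E ->
  g \in Lfun pi 2%:E ->
  chain_var n (fun x => f x + g x) + chain_var n (fun x => f x - g x) =
  2 * chain_var n f + 2 * chain_var n g.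
Proof.
move=> f2 g2; rewrite /chain_var centerD// centerB//.
by apply: chain_sum_sq_parallelogram => //; exact: Lfun2_center.
Qed.

Lemma chain_var_triangle n f g : f \in Lfun pi 2%:E -> g \in Lfun pi 2%:E ->
  chain_var n f <= 2 * chain_var n g + 2 * chain_var n (fun x => f x - g x).
Proof.
move=> f2 g2; rewrite /chain_var centerB//.
by apply: chain_sum_sq_triangle => //; exact: Lfun2_center.
Qed.

Lemma chain_varZ n a f : f \in Lfun pi 2%:E ->
  chain_var n (fun x => a * f x) = a ^+ 2 * chain_var n f.
Proof.
move=> f2; rewrite /chain_var -chain_sum_sqZ//; last exact: Lfun2_center.
congr chain_sum_sq; apply/funext => x; rewrite /center RintegralZl//.
  by rewrite mulrBr.
exact: Lfun2_integrable.
Qed.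

(** With [p = pi S], the exit probability over at most [n] steps is at most [p / 4], so each of the
    [(n + 1)^2] covariances is at least [p - p / 4 - p^2 >= p / 4]. *)
Lemma chain_var_indic_ge n S kappa : measurable S -> (pi S <= 2^-1%:E)%E ->
  lag_cov pi P 1 \1_S \1_(~` S) <= kappa * fine (pi S) ->
  n%:R * kappa <= 4^-1 ->
  n.+1%:R ^+ 2 / 4 * fine (pi S) <= chain_var n \1_S.
Proof.
move=> mS S12 kS nk; have S2 := Lfun2_indic pi mS.
set p := fine (pi S).
have p12 : p <= 2^-1 by rewrite -lee_fin fineK ?fin_num_measure.
have p0 : 0 <= p by exact: fine_ge0.
have F0 : 0 <= lag_cov pi P 1 \1_S \1_(~` S) by exact: lag_cov_ge0.
rewrite /chain_var chain_sum_sqE//; last exact: Lfun2_center.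
have -> : n.+1%:R ^+ 2 / 4 * p = \sum_(i < n.+1) \sum_(j < n.+1) (p / 4) :> R.
  rewrite !sumr_const !card_ord -(mulr_natl (p / 4)).
  by rewrite -(mulr_natl (n.+1%:R * (p / 4))); ring.
apply: ler_sum => i _; apply: ler_sum => j _.
rewrite lag_cov_center// Rintegral_indic// -/p.
set k := (_ + _)%N.
have kn : (k <= n)%N by rewrite /k; have := ltn_ord i; have := ltn_ord j; lia.
have := lag_cov_indic_le k mS; rewrite lag_cov_indicC// -/p => h.
have h1 : k%:R * lag_cov pi P 1 \1_S \1_(~` S) <= n%:R * (kappa * p).
  by apply: ler_pM => //; rewrite ler_nat.
have h2 : n%:R * (kappa * p) <= 4^-1 * p by rewrite mulrA ler_wpM2r.
have h3 : p ^+ 2 <= 2^-1 * p by rewrite expr2 ler_wpM2r.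
lra.
Qed.

End low_conductance.

Lemma limn_esup_bounded (R : realType) (u : nat -> R) k (a b : R) :
  (forall m, (k <= m)%N -> a <= u m <= b) ->
  (a%:E <= limn_esup (EFin \o u) <= b%:E)%E.
Proof.
move=> uab; rewrite /limn_esup /limf_esup; apply/andP; split.
  apply: le_ereal_inf_tmp => _ [V [N _ NV] <-].
  apply: (@le_trans _ _ (u (maxn k N))%:E).
    by rewrite lee_fin; have /andP[] := uab (maxn k N) (leq_maxl _ _).
  apply: ereal_sup_ubound; exists (maxn k N) => //.
  by apply: NV => /=; exact: leq_maxr.
apply: ge_ereal_inf.
exists (ereal_sup ((EFin \o u) @` [set m | (k <= m)%N])).
  by exists [set m | (k <= m)%N] => //; exists k.
apply: ge_ereal_sup => _ [m /= km <-].
by rewrite lee_fin; have /andP[] := uab m km.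
Qed.

(** * Limits of sequences with geometrically small increments *)

Section square_integrable_series.
Context d (T : measurableType d) (R : realType)
  (mu : {finite_measure set T -> \bar R}).
Variables (w x : nat -> T -> R) (r : R).
Hypothesis r01 : 0 < r < 1.
Hypothesis mw : forall k, measurable_fun setT (w k).
Hypothesis w1 : forall k, (\int[mu]_t (w k t ^+ 2)%:E <= 1)%E.
Hypothesis x2 : forall k, x k \in Lfun mu 2%:E.
Hypothesis xw : forall k t, `|x k.+1 t - x k t| <= r ^+ k * `|w k t|.

Let r0 : 0 < r. Proof. by case/andP: r01. Qed.
Let r1 : r < 1. Proof. by case/andP: r01. Qed.
Let A k := r ^+ k / (1 - r).

Let A0 k : 0 < A k.
Proof. by rewrite divr_gt0 ?exprn_gt0// subr_gt0. Qed.

Let AS k : A k = r ^+ k + A k.+1.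
Proof. by rewrite /A exprS; field; rewrite subr_eq0 gt_eqF. Qed.

(** Weighted Cauchy-Schwarz, [A k] being the sum of [r ^+ j] over [j >= k]. In the induction,
    Young's inequality splits this weight into [r ^+ k] for the first increment and [A k.+1] for the
    rest. *)
Let increment_le m k t : (x (k + m) t - x k t) ^+ 2 <=
  A k * \sum_(j < m) r ^+ (k + j) * w (k + j) t ^+ 2.
Proof.
elim: m k => [|m IH] k; first by rewrite addn0 subrr expr0n big_ord0 mulr0.
rewrite big_ord_recl addn0 -addSnnS.
under eq_bigr do rewrite /= -[bump 0 _]add1n addnA addn1.
have := IH k.+1; set b := \sum_(_ < _) _ => D.
have e : (x k.+1 t - x k t) ^+ 2 <= (r ^+ k) ^+ 2 * w k t ^+ 2.
  rewrite -exprMn -[leLHS]real_normK ?num_real// -[leRHS]real_normK ?num_real//.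
  by rewrite ler_sqr ?nnegrE// normrM (ger0_norm (exprn_ge0 _ (ltW r0))).
have rk : 0 < r ^+ k by exact: exprn_gt0.
have s0 : 0 < r ^+ k / A k.+1 by rewrite divr_gt0.
set u := x (k.+1 + m) t - x k.+1 t in D *; set v := x k.+1 t - x k t in e *.
have -> : x (k.+1 + m) t - x k t = u + v by rewrite /u /v; ring.
have young : (u + v) ^+ 2 <=
    (1 + r ^+ k / A k.+1) * u ^+ 2 + (1 + A k.+1 / r ^+ k) * v ^+ 2.
  rewrite -subr_ge0 (_ : _ - _ =
    (A k.+1 * r ^+ k)^-1 * (r ^+ k * u - A k.+1 * v) ^+ 2).
    by rewrite mulr_ge0 ?sqr_ge0// invr_ge0 mulr_ge0// ltW.
  by field; rewrite !gt_eqF.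
apply: (le_trans young).
have -> : A k * (r ^+ k * w k t ^+ 2 + b) =
    (1 + r ^+ k / A k.+1) * (A k.+1 * b) +
    (1 + A k.+1 / r ^+ k) * ((r ^+ k) ^+ 2 * w k t ^+ 2).
  by rewrite AS; field; rewrite !gt_eqF.
by apply: lerD; apply: ler_wpM2l => //; rewrite addr_ge0// ltW// divr_gt0.
Qed.

Let W k t := (\sum_(0 <= j <oo) (r ^+ (k + j) * w (k + j) t ^+ 2)%:E)%E.

Let term_ge0 k j t : (0 <= (r ^+ (k + j) * w (k + j) t ^+ 2)%:E)%E.
Proof. by rewrite lee_fin mulr_ge0 ?sqr_ge0// exprn_ge0// ltW. Qed.

Let W0 k t : (0 <= W k t)%E.
Proof. by apply: nneseries_ge0 => j _ _; exact: term_ge0. Qed.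

Let increment_le_series m k t : (k <= m)%N ->
  (((x m t - x k t) ^+ 2)%:E <= (A k)%:E * W k t)%E.
Proof.
move=> km; rewrite -(subnKC km).
apply: (@le_trans _ _ (A k *
    \sum_(j < m - k) r ^+ (k + j) * w (k + j) t ^+ 2)%:E).
  by rewrite lee_fin increment_le.
rewrite EFinM lee_pmul2l//; last by rewrite lte_fin.
rewrite -sumEFin -(big_mkord xpredT
  (fun j => (r ^+ (k + j) * w (k + j) t ^+ 2)%:E)).
by apply: nneseries_lim_ge => j _ _; exact: term_ge0.
Qed.

Let h t := fine (limn_esup (fun m => (x m t)%:E)).

Let limit_le k t : (((h t - x k t) ^+ 2)%:E <= (A k)%:E * W k t)%E.
Proof.
have := W0 k t; case E : (W k t) => [v| |] // v0; last first.
  by rewrite gt0_muley ?lte_fin// leey.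
rewrite -EFinM lee_fin; rewrite lee_fin in v0.
(* All [x m t] with [m >= k] lie within [B] of [x k t]; hence so does their upper limit, which is
   therefore finite. *)
set B := Num.sqrt (A k * v).
have BE : B ^+ 2 = A k * v by rewrite sqr_sqrtr// mulr_ge0// ltW.
have bnd m : (k <= m)%N -> x k t - B <= x m t <= x k t + B.
  move=> km; rewrite -ler_distl -ler_sqr ?nnegrE ?sqrtr_ge0//.
  rewrite real_normK ?num_real// BE -lee_fin (EFinM (A k)) -E.
  exact: increment_le_series.
have /andP[] := limn_esup_bounded bnd.
rewrite /h /=; case: (limn_esup _) => [l| |] //=.
rewrite !lee_fin -BE => h1 h2.
rewrite -real_normK ?num_real// ler_sqr ?nnegrE ?sqrtr_ge0//.
by rewrite ler_distl h1.
Qed.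

Let mh : measurable_fun setT h.
Proof.
apply: measurableT_comp => //; apply: measurable_fun_limn_esup => m.
by apply/measurable_EFinP; exact: Lfun2_measurable (x2 m).
Qed.

Let integral_W k : (\int[mu]_t W k t <= (A k)%:E)%E.
Proof.
rewrite integral_nneseries//; last first.
  move=> j; apply/measurable_EFinP; apply: measurable_funM => //.
  exact: measurable_funX.
apply: lime_le.
  apply: is_cvg_nneseries => j _ _; apply: integral_ge0 => t _.
  exact: term_ge0.
apply: nearW => n.
apply: (@le_trans _ _ (\sum_(0 <= j < n) (r ^+ (k + j))%:E)%E).
  apply: lee_sum => j _.
  under eq_integral do rewrite EFinM.
  rewrite ge0_integralZl//.
  - rewrite -[leRHS]mule1; apply: lee_wpmul2l => //.
    by rewrite lee_fin exprn_ge0// ltW.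
  - by apply/measurable_EFinP; exact: measurable_funX.
  - by move=> t _; rewrite lee_fin sqr_ge0.
  - by rewrite lee_fin exprn_ge0// ltW.
rewrite sumEFin lee_fin.
suff : \sum_(0 <= j < n) r ^+ (k + j) = A k - A (k + n) by move=> ->; rewrite lerBlDr lerDl ltW.
elim: n => [|n IH]; first by rewrite big_geq// addn0 subrr.
by rewrite big_nat_recr//= IH addnS (AS (k + n)); ring.
Qed.

Let integral_sqr_limit k :
  (\int[mu]_t ((h t - x k t) ^+ 2)%:E <= (A k ^+ 2)%:E)%E.
Proof.
have mW : measurable_fun setT (W k).
  apply: ge0_emeasurable_sum => //.
  move=> j _; apply/measurable_EFinP; apply: measurable_funM => //.
  exact: measurable_funX.
apply: (@le_trans _ _ (\int[mu]_t ((A k)%:E * W k t))%E).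
  apply: ge0_le_integral => //.
  - by move=> t _; rewrite lee_fin sqr_ge0.
  - apply/measurable_EFinP; apply: measurable_funX; apply: measurable_funB => //.
    exact: Lfun2_measurable.
  - exact: measurable_funeM.
rewrite ge0_integralZl//; last by rewrite lee_fin ltW.
rewrite expr2 (EFinM (A k) (A k)); apply: lee_wpmul2l; last exact: integral_W.
by rewrite lee_fin ltW.
Qed.

(* The limit is the upper limit of the [x n]; the weighted Cauchy-Schwarz bound
   [limit_le] is infinite where the series diverges, so it holds everywhere. *)
Lemma Lfun2_geometric_limit : exists2 h : T -> R, h \in Lfun mu 2%:E &
  forall k, \int[mu]_t (h t - x k t) ^+ 2 <= (r ^+ k / (1 - r)) ^+ 2.
Proof.
have hx2 k : (fun t => h t - x k t) \in Lfun mu 2%:E.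
  apply/Lfun2P; split.
    by apply: measurable_funB => //; exact: Lfun2_measurable.
  exact: le_lt_trans (integral_sqr_limit k) (ltry _).
exists h => [|k].
  rewrite (_ : h = fun t => (h t - x 0%N t) + x 0%N t); first exact: Lfun2D.
  by apply/funext => t; rewrite subrK.
rewrite -lee_fin /Rintegral fineK; first exact: integral_sqr_limit.
exact: integrable_fin_num (Lfun2_integrable_sqr (hx2 k)).
Qed.

End square_integrable_series.

Section conductance_necessary.
Context d (T : measurableType d) (R : realType) (pi : probability T R)
  (P : R.-pker T ~> T).
Hypothesis piP : stationary pi P.
Implicit Types (f g h : T -> R) (S : set T).

Lemma variance_bounding_chain_var h : variance_bounding pi P ->
  h \in Lfun pi 2%:E ->
  exists C, \forall n \near \oo, chain_var pi P n h <= C * n.+1%:R.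
Proof.
move=> vb h2; have [v hv voo] := vb h h2.
have [C vC] : exists C : R, (v < C%:E)%E.
  case: v voo {hv} => [v| |] // _.
    by exists (v + 1); rewrite lte_fin ltrDl.
  by exists 0; rewrite ltNyr.
exists C; move: hv; rewrite /has_asymptotic_variance.
under eq_fun do rewrite variance_empirical_mean//.
move=> hv.
have [n0 _ h0] := hv _ (open_ereal_lt' vC).
exists n0 => // n /h0; rewrite /= lte_fin ltr_pdivrMr// => /ltW.
exact.
Qed.

(** * The gliding hump *)

Section hump.
Variables (w : nat -> T -> R) (N : nat -> nat).
Hypothesis w2 : forall k, w k \in Lfun pi 2%:E.

Let z k t := 8^-1 ^+ k * w k t.

Let z2 k : z k \in Lfun pi 2%:E.
Proof. exact: Lfun2Z (w2 k). Qed.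

(* By the parallelogram identity one of the two signs does not decrease the
   variance at time [N k] below that of the [k]-th term. *)
Fixpoint signed_sum k : T -> R := if k is m.+1 then
    let y := signed_sum m in
    if chain_var pi P (N m) (z m) <= chain_var pi P (N m) (fun t => y t + z m t)
    then fun t => y t + z m t else fun t => y t - z m t
  else cst 0.

Lemma Lfun2_signed_sum k : signed_sum k \in Lfun pi 2%:E.
Proof.
elim: k => [|k IH] /=; first exact: Lfun_cst.
by case: ifP => _; [exact: Lfun2D|exact: Lfun2B].
Qed.

Lemma signed_sum_increment k t :
  `|signed_sum k.+1 t - signed_sum k t| <= 8^-1 ^+ k * `|w k t|.
Proof.
have -> : 8^-1 ^+ k * `|w k t| = `|z k t|.
  by rewrite /z normrM (ger0_norm (exprn_ge0 _ _))// invr_ge0.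
rewrite /=; case: ifP => _; first by rewrite addrC addKr.
by rewrite addrAC subrr sub0r normrN.
Qed.

Lemma signed_sum_var k :
  (8^-1 ^+ k) ^+ 2 * chain_var pi P (N k) (w k) <=
  chain_var pi P (N k) (signed_sum k.+1).
Proof.
rewrite -chain_varZ// -/(z k) /=; case: ifPn => //; rewrite -ltNge => yz.
(* If the plus sign falls short, that is [b < a], the minus sign gives [c = 2 e + 2 a - b > a]. *)
have := chain_var_parallelogram piP (N k) (Lfun2_signed_sum k) (z2 k).
have := chain_var_ge0 pi P (N k) (signed_sum k).
move: yz; set a := chain_var _ _ _ (z k); set b := chain_var _ _ _ (fun t => _ + _).
set c := chain_var _ _ _ (fun t => _ - _); set e := chain_var _ _ _ (signed_sum k).
by move: a b c e => a b c e; lra.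
Qed.

End hump.

Lemma variance_bounding_conductance : variance_bounding pi P ->
  exists2 kappa, 0 < kappa & conductance_ge pi P kappa.
Proof.
move=> vb; apply: contrapT => noK.
(* [N k * kap k = 1 / 4] is what [chain_var_indic_ge] asks for. The coefficients [8^-1 ^+ k] cost
   [64 ^ k] in variance, so the normalised variance still grows like [128 ^ k / 64 ^ k = 2 ^ k]. *)
pose N k := (128 ^ k)%N; pose kap k : R := (4 * 128 ^+ k)^-1.
have kap0 k : 0 < kap k by rewrite invr_gt0 mulr_gt0// exprn_gt0.
have /choice[S HS] : forall k, exists S, [/\ measurable S, (pi S <= 2^-1%:E)%E &
    lag_cov pi P 1 \1_S \1_(~` S) < kap k * fine (pi S)].
  move=> k; apply: contrapT => noS; apply: noK; exists (kap k) => // S mS S12.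
  rewrite leNgt; apply/negP => ltS; apply: noS; by exists S.
pose p k := fine (pi (S k)).
(* The exit flow is nonnegative and strictly below [kap k * p k], so [S k] is not null and its
   indicator can be normalised. *)
have p0 k : 0 < p k.
  have [_ _ ] := HS k; rewrite -(pmulr_rgt0 _ (kap0 k)).
  by apply: le_lt_trans; exact: lag_cov_ge0.
pose w k t := (Num.sqrt (p k))^-1 * \1_(S k) t.
have S2 k : \1_(S k) \in Lfun pi 2%:E.
  by apply: Lfun2_indic; have [] := HS k.
have w2 k : w k \in Lfun pi 2%:E by exact: Lfun2Z (S2 k).
have wE k t : w k t ^+ 2 = (p k)^-1 * \1_(S k) t.
  rewrite exprMn exprVn sqr_sqrtr ?ltW//; congr (_ * _).
  by rewrite indicE; case: (_ \in _); rewrite ?expr0n ?expr1n.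
have w1 k : (\int[pi]_t (w k t ^+ 2)%:E <= 1)%E.
  have [mS _ _] := HS k.
  under eq_integral do rewrite wE EFinM.
  rewrite ge0_integralZl//; last 2 first.
  - by apply/measurable_EFinP; exact: measurable_indic.
  - by rewrite lee_fin invr_ge0 ltW.
  have pE : pi (S k) = (p k)%:E by rewrite fineK// fin_num_measure.
  by rewrite integral_indic// setIT [X in (_ * X)%E]pE -EFinM mulVf// gt_eqF.
have wvar k : (N k).+1%:R ^+ 2 / 4 <= chain_var pi P (N k) (w k).
  have [mS S12 lS] := HS k.
  rewrite chain_varZ// exprVn sqr_sqrtr; last exact: ltW.
  rewrite ler_pdivlMl//.
  rewrite mulrC; apply: (chain_var_indic_ge piP mS S12 (ltW lS)).
  rewrite /N /kap natrX invfM mulrCA mulfV ?mulr1//.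
have r01 : 0 < (8^-1 : R) < 1 by rewrite invr_gt0 ltr0n invf_lt1 ?ltr1n ?ltr0n.
have [h h2 hx] := Lfun2_geometric_limit (r := 8^-1) r01
  (fun k => Lfun2_measurable (w2 k)) w1
  (Lfun2_signed_sum N w2) (signed_sum_increment w N).
have [C [n0 _ hC]] := variance_bounding_chain_var vb h2.
have big k : (n0 <= N k)%N -> 2 ^+ k <= 16 * C.
  move=> nk; have := hC _ nk.
  set X := signed_sum w N k.+1.
  have X2 : X \in Lfun pi 2%:E by exact: Lfun2_signed_sum.
  have t1 := chain_var_triangle piP (N k) X2 h2.
  have t2 := chain_var_le piP (N k) (Lfun2B X2 h2).
  have t3 := signed_sum_var N w2 k.
  have t4 := wvar k.
  (* The tail after the [k]-th term: [8^-(k+1) / (1 - 1/8) = 8^-k / 7]. *)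
  have t5 : \int[pi]_t (X t - h t) ^+ 2 <= (8^-1 ^+ k / 7) ^+ 2.
    have := hx k.+1; rewrite (_ : 8^-1 ^+ k.+1 / (1 - 8^-1) = 8^-1 ^+ k / 7).
      apply: le_trans; rewrite le_eqVlt; apply/orP; left; apply/eqP.
      by apply: eq_Rintegral => t _; rewrite -sqrrN opprB.
    by rewrite exprS; field.
  set q := 8^-1 ^+ k in t3 t5; set M := (N k).+1%:R in t2 t4 *.
  move=> t6; have M0 : 0 < M by exact: ltr0Sn.
  have t7 : M ^+ 2 * \int[pi]_t (X t - h t) ^+ 2 <= M ^+ 2 * (q / 7) ^+ 2.
    by rewrite ler_wpM2l ?sqr_ge0.
  have t8 : q ^+ 2 * (M ^+ 2 / 4) <= q ^+ 2 * chain_var pi P (N k) (w k).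
    by rewrite ler_wpM2l ?sqr_ge0.
  (* From [q^2 M^2 / 4 <= 2 V + 2 q^2 M^2 / 49], where [V] is the variance for [h], follows
     [V >= q^2 M^2 / 16], to be compared with [V <= C M]. *)
  have t9 : q ^+ 2 * M / 16 <= C.
    rewrite -(ler_pM2r M0); have : 0 <= q ^+ 2 * M ^+ 2 by rewrite mulr_ge0 ?sqr_ge0.
    have -> : q ^+ 2 * M / 16 * M = q ^+ 2 * M ^+ 2 / 16 by ring.
    have e1 : M ^+ 2 * (q / 7) ^+ 2 = q ^+ 2 * M ^+ 2 / 49 by field.
    have e2 : q ^+ 2 * (M ^+ 2 / 4) = q ^+ 2 * M ^+ 2 / 4 by ring.
    move: t1 t2 t3 t6 t7 t8; rewrite e1 e2.
    move: (chain_var _ _ _ X) (chain_var _ _ _ h)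
      (chain_var _ _ _ (fun t => X t - h t)).
    move: (_ * chain_var _ _ _ _) (_ * \int[_]_t _) (C * M) (_ * M ^+ 2).
    by move=> a1 a2 a3 a4 a5 a6 a7; lra.
  rewrite ler_pdivrMr// [C * 16]mulrC in t9; apply: le_trans t9.
  have -> : 2 ^+ k = q ^+ 2 * 128 ^+ k.
    rewrite /q -exprM mulnC exprM -exprMn; congr (_ ^+ k).
    have -> : 128 = 2 * 8 ^+ 2 :> R by rewrite -natrX -natrM.
    by rewrite mulrCA -exprMn mulVf ?expr1n ?mulr1// pnatr_eq0.
  by rewrite ler_wpM2l ?sqr_ge0// /M /N -natrX ler_nat.
(* This gives [n0 <= k < N k] and [2 ^ k > k >= Num.bound (16 * C)], contradicting [big]. *)
pose k := maxn n0 (Num.bound (16 * C)).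
have C0 : 0 <= 16 * C.
  have := big n0 (leq_trans (ltnW (ltn_expl n0 (isT : 1 < 128)%N)) (leqnn _)).
  by apply: le_trans; rewrite exprn_ge0.
have kN : (n0 <= N k)%N.
  by rewrite (leq_trans (leq_maxl _ _ : (n0 <= k)%N))// ltnW// ltn_expl.
have := big k kN; rewrite leNgt => /negP; apply.
apply: (lt_trans (archi_boundP C0)); rewrite -natrX ltr_nat.
by apply: (leq_ltn_trans (leq_maxr n0 _)); exact: ltn_expl.
Qed.

End conductance_necessary.

(** * Transfer of the conductance *)

Section overlap.
Context d (T : measurableType d) (R : realType)
  (mu : {measure set T -> \bar R}) (pi : probability T R).

Lemma lag_cov1E (P : R.-pker T ~> T) S : stationary pi P -> measurable S ->
  lag_cov pi P 1 \1_S \1_(~` S) =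
  fine (\int[pi]_(x in S) P x (~` S))%E.
Proof.
move=> piP mS; have mSC := measurableC mS.
have := @integral_chain_pair _ _ _ _ _ piP 1 ord0 ord_max
  (EFin \o \1_S) (EFin \o \1_(~` S)) isT.
rewrite /lag_cov /Rintegral => -> //; last 4 first.
- by move=> x; rewrite lee_fin.
- by apply/measurable_EFinP; exact: measurable_indic.
- by move=> x; rewrite lee_fin.
- by apply/measurable_EFinP; exact: measurable_indic.
congr fine; rewrite [RHS]integral_mkcond; apply: eq_integral => x _.
rewrite /= /kernel_operator integral_indic// setIT patchE indicE.
by case: (x \in S); rewrite ?mul1e ?mul0e.
Qed.

(** A rejected proposal leaves the chain at [x], inside [S], so the atom does not contribute. *)
Lemma propose_accept_reject_flow (q alpha : T -> T -> R) (P : R.-pker T ~> T)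
    S x : propose_accept_reject mu q alpha P -> measurable S -> S x ->
  P x (~` S) = (\int[mu]_(y in ~` S) (q x y * alpha x y)%:E)%E.
Proof.
move=> [_ _ _ PE] mS Sx; rewrite PE; last exact: measurableC.
have -> : \d_x (~` S) = 0%E :> \bar R by rewrite diracE memNset// => /(_ Sx).
by rewrite mule0 adde0.
Qed.

(** The complement of [S] is split along [D]: inside [D] the accepted densities are comparable, and
    outside [D] the first kernel has accepted mass at most [eps]. *)
Lemma propose_accept_reject_overlap (qA alphaA qB alphaB : T -> T -> R)
    (PA PB : R.-pker T ~> T) S D x (eps delta : R) :
  propose_accept_reject mu qA alphaA PA ->
  propose_accept_reject mu qB alphaB PB ->
  0 < delta -> measurable S -> S x -> measurable D ->
  (\int[mu]_(y in ~` D) (qA x y * alphaA x y)%:E <= eps%:E)%E ->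
  (forall y, D y -> delta * (qA x y * alphaA x y) <= qB x y * alphaB x y) ->
  (delta%:E * PA x (~` S) <= PB x (~` S) + (delta * eps)%:E)%E.
Proof.
move=> parA parB delta0 mS Sx mD Deps AB; have mSC := measurableC mS.
rewrite (propose_accept_reject_flow parA)// (propose_accept_reject_flow parB)//.
have [/(_ x)[mqA qA0 _] /(_ x) maA /(_ x) aA01 _] := parA.
have [/(_ x)[mqB qB0 _] /(_ x) maB /(_ x) aB01 _] := parB.
pose fA y := qA x y * alphaA x y; pose fB y := qB x y * alphaB x y.
have mfA E : measurable_fun E (EFin \o fA).
  by apply: measurable_funTS; apply/measurable_EFinP; exact: measurable_funM.
have mfB E : measurable_fun E (EFin \o fB).
  by apply: measurable_funTS; apply/measurable_EFinP; exact: measurable_funM.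
have fA0 y : (0 <= (fA y)%:E)%E.
  by rewrite lee_fin mulr_ge0//; case/andP: (aA01 y).
have fB0 y : (0 <= (fB y)%:E)%E.
  by rewrite lee_fin mulr_ge0//; case/andP: (aB01 y).
have -> : (\int[mu]_(y in ~` S) (fA y)%:E =
    \int[mu]_(y in ~` S `&` D) (fA y)%:E +
    \int[mu]_(y in ~` S `&` ~` D) (fA y)%:E)%E.
  rewrite -ge0_integral_setU//.
  - by rewrite -setIUr setUv setIT.
  - exact: measurableI.
  - by apply: measurableI => //; exact: measurableC.
  - by apply/disj_setPS => y [[_ ?] [_]].
have mSD : measurable (~` S `&` D) by exact: measurableI.
have mSDC : measurable (~` S `&` ~` D).
  by apply: measurableI => //; exact: measurableC.
rewrite ge0_muleDr ?integral_ge0//; apply: leeD.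
  rewrite -ge0_integralZl//; last by rewrite lee_fin ltW.
  apply: (@le_trans _ _ (\int[mu]_(y in ~` S `&` D) (fB y)%:E)%E).
    apply: ge0_le_integral => //.
    - by move=> y _; rewrite mule_ge0// lee_fin ltW.
    - exact: measurable_funeM.
    - by move=> y [_ Dy]; rewrite -EFinM lee_fin AB.
  by apply: ge0_subset_integral => //; exact: subIsetl.
rewrite EFinM lee_pmul2l ?lte_fin//; apply: le_trans Deps.
apply: ge0_subset_integral => //; exact: measurableC.
Qed.

(** Integrating the pointwise comparison over [S] leaves an exit flow of at least
    [delta * (kappa - kappa / 2) * pi S]. *)
Lemma overlap_conductance (qA alphaA qB alphaB : T -> T -> R)
    (PA PB : R.-pker T ~> T) (kappa delta : R) :
  propose_accept_reject mu qA alphaA PA ->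
  propose_accept_reject mu qB alphaB PB ->
  stationary pi PA -> stationary pi PB ->
  conductance_ge pi PA kappa -> 0 < kappa -> 0 < delta ->
  {ae pi, forall x, exists D, [/\ measurable D,
    (\int[mu]_(y in ~` D) (qA x y * alphaA x y)%:E <= (kappa / 2)%:E)%E &
    forall y, D y -> delta * (qA x y * alphaA x y) <= qB x y * alphaB x y]} ->
  conductance_ge pi PB (delta * kappa / 2).
Proof.
move=> parA parB piA piB condA kappa0 delta0 ov S mS S12.
have := condA S mS S12; rewrite !lag_cov1E//.
have mSC := measurableC mS.
have flow_fin (P : R.-pker T ~> T) :
    (\int[pi]_(x in S) P x (~` S) \is a fin_num)%E.
  rewrite ge0_fin_numE; last exact: integral_ge0.
  apply: (@le_lt_trans _ _ (\int[pi]_(x in S) 1)%E).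
    apply: ge0_le_integral => //.
    - by apply: measurable_funTS; exact: measurable_kernel.
    - by move=> x _; rewrite -(prob_kernel (s := P) x) le_measure ?inE.
  by rewrite integral_cst// mul1e ltey_eq fin_num_measure.
move=> hA.
have : (delta%:E * \int[pi]_(x in S) PA x (~` S) <=
    \int[pi]_(x in S) PB x (~` S) + (delta * (kappa / 2))%:E * pi S)%E.
  rewrite -ge0_integralZl//; last 2 first.
  - by apply: measurable_funTS; exact: measurable_kernel.
  - by rewrite lee_fin ltW.
  rewrite -integral_cst// -ge0_integralD//; last 2 first.
  - by apply: measurable_funTS; exact: measurable_kernel.
  - by move=> x _; rewrite lee_fin mulr_ge0// ltW// divr_gt0.
  apply: ae_ge0_le_integral => //.
  - by move=> x _; rewrite mule_ge0// lee_fin ltW.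
  - apply: measurable_funeM; apply: measurable_funTS; exact: measurable_kernel.
  - by move=> x _; rewrite adde_ge0// lee_fin mulr_ge0// ltW// divr_gt0.
  - apply: emeasurable_funD => //.
    by apply: measurable_funTS; exact: measurable_kernel.
  - apply: filterS ov => x [D [mD Deps AB]] Sx.
    exact: (propose_accept_reject_overlap parA parB delta0 mS Sx mD Deps AB).
rewrite -(fineK (flow_fin PA)) -(fineK (flow_fin PB)).
rewrite -[pi S]fineK ?fin_num_measure// -!EFinM -EFinD lee_fin.
have : delta * (kappa * fine (pi S)) <=
  delta * fine (\int[pi]_(x in S) PA x (~` S)) by rewrite ler_pM2l.
lra.
Qed.

End overlap.

Local Open Scope ereal_scope.

Theorem theorem1 (R : realType) (d : nat) (X : state_space R d)
    (pi : probability (state X) R)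
    (PA PB : R.-pker state X ~> state X)
    (qA qB alphaA alphaB : state X -> state X -> R)
    (pi_density : has_density (lebesgue_on X) pi)
    (parA : propose_accept_reject (lebesgue_on X) qA alphaA PA)
    (parB : propose_accept_reject (lebesgue_on X) qB alphaB PB)
    (piA : stationary pi PA)
    (piB : stationary pi PB)
    (vbA : variance_bounding pi PA)
    (overlap : forall eps : R, (0 < eps)%R -> exists2 delta : R, (0 < delta)%R &
      {ae pi, forall x : state X, exists D : set (state X),
        [/\ measurable D,
            \int[lebesgue_on X]_(y in ~` D) (qA x y * alphaA x y)%:E <= eps%:E &
            forall y, D y ->
              (delta * (qA x y * alphaA x y) <= qB x y * alphaB x y)%R]}) :
  variance_bounding pi PB.
Proof.
have [kappa kappa0 condA] := variance_bounding_conductance piA vbA.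
have kappa20 : (0 < kappa / 2)%R by rewrite divr_gt0.
have [delta delta0 ov] := overlap _ kappa20.
apply: (conductance_variance_bounding (kappa := delta * kappa / 2) piB).
  by rewrite divr_gt0// mulr_gt0.
exact: (overlap_conductance parA parB piA piB condA kappa0 delta0 ov).
Qed.
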